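(* Let $d\ge2$, $1\le m<d$, $\delta\in(0,1)$. Let $f=(f_1,\dots,f_L):\mathbb{R}^d\to\mathbb{R}^L$ be a classifier with continuous components whose pairwise decision boundaries are smooth hypersurfaces, fix $\boldsymbol{x}_0\in\mathbb{R}^d$ with $f_{\hat k}(\boldsymbol{x}_0)>f_k(\boldsymbol{x}_0)$ for all $k\ne\hat k$, and fix a class $k\neq\hat k$ with $\|\boldsymbol{r}^k\|_2<\infty$. Let $\kappa:=\kappa(\mathscr{B}_k)$ and assume $$\kappa\le\frac{C}{\zeta_2(m,\delta)\,\|\boldsymbol{r}^k\|_2}\,\frac{m}{d}.$$ Let $\mathcal{S}$ be a random $m$-dimensional subspace of $\mathbb{R}^d$. Then, with probability at least $1-4\delta$, $$\Big(1-C_1\|\boldsymbol{r}^k\|_2\,\kappa\,\zeta_2(m,\delta)\tfrac{d}{m}\Big)\sqrt{\zeta_1(m,\delta)}\sqrt{\tfrac dm}\;\le\;\frac{\|\boldsymbol{r}^k_{\mathcal S}\|_2}{\|\boldsymbol{r}^k\|_2}\;\le\;\Big(1+C_2\|\boldsymbol{r}^k\|_2\,\kappa\,\zeta_2(m,\delta)\tfrac{d}{m}\Big)\sqrt{\zeta_2(m,\delta)}\sqrt{\tfrac dm},$$ where $C=0.2$, $C_1=0.625$, $C_2=2.25$.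
   Context: For an $L$-class classifier $f=(f_1,\dots,f_L):\mathbb{R}^d\to\mathbb{R}^L$ and a point $\boldsymbol{x}_0$ with estimated label $\hat k=\arg\max_k f_k(\boldsymbol{x}_0)$, and for a linear subspace $\mathcal{S}\subseteq\mathbb{R}^d$ and $k\neq\hat k$, define $\|\boldsymbol{r}^k_{\mathcal S}\|_2=\inf\{\|\boldsymbol{r}\|_2:\boldsymbol{r}\in\mathcal{S},\ f_k(\boldsymbol{x}_0+\boldsymbol{r})\ge f_{\hat k}(\boldsymbol{x}_0+\boldsymbol{r})\}$ (with $\inf\emptyset=+\infty$) and $\|\boldsymbol{r}^k\|_2:=\|\boldsymbol{r}^k_{\mathbb{R}^d}\|_2$. A random $m$-dimensional subspace of $\mathbb{R}^d$ is the span of $m$ independent vectors drawn uniformly from the unit sphere $\mathbb{S}^{d-1}$. For $m\ge1$ and $\delta\in(0,1)$, $\zeta_1(m,\delta)=\Big(1+2\sqrt{\tfrac{\ln(1/\delta)}{m}}+\tfrac{2\ln(1/\delta)}{m}\Big)^{-1}$ and $\zeta_2(m,\delta)=\Big(\max\big(\tfrac1e\delta^{2/m},\,1-\sqrt{2(1-\delta^{2/m})}\big)\Big)^{-1}$. Curvature: for classes $i\ne j$, let $\mathscr{B}_{i,j}=\{\boldsymbol{x}:f_i(\boldsymbol{x})-f_j(\boldsymbol{x})=0\}$, $\mathcal{R}_i=\{\boldsymbol{x}:f_i(\boldsymbol{x})>f_j(\boldsymbol{x})\}$, $\mathcal{R}_j=\{\boldsymbol{x}:f_j(\boldsymbol{x})>f_i(\boldsymbol{x})\}$.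 For $\boldsymbol{p}\in\mathscr{B}_{i,j}$ let $q_{i\|j}(\boldsymbol{p})=\sup\{\|\boldsymbol{z}-\boldsymbol{p}\|_2:\boldsymbol{z}\in\mathbb{R}^d,\ \mathbb{B}(\boldsymbol{z},\|\boldsymbol{z}-\boldsymbol{p}\|_2)\subseteq\mathcal{R}_i\}$, where $\mathbb{B}(\boldsymbol{z},\rho)$ is the open Euclidean ball of center $\boldsymbol{z}$ and radius $\rho$ (the radius of the largest open ball contained in $\mathcal{R}_i$ whose boundary passes through $\boldsymbol{p}$). Let $q_{i,j}(\boldsymbol{p})=\min(q_{i\|j}(\boldsymbol{p}),q_{j\|i}(\boldsymbol{p}))$, $q(\mathscr{B}_{i,j})=\inf_{\boldsymbol{p}\in\mathscr{B}_{i,j}}q_{i,j}(\boldsymbol{p})$ and $\kappa(\mathscr{B}_{i,j})=1/q(\mathscr{B}_{i,j})$ (with $1/\infty=0$). Write $\mathscr{B}_k:=\mathscr{B}_{k,\hat k}$. *)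

(* Defs.v *)
From HB Require Import structures.
From mathcomp Require Import all_boot all_order all_algebra.
From mathcomp Require Import all_classical all_reals all_analysis.

Set Implicit Arguments.
Unset Strict Implicit.
Unset Printing Implicit Defensive.

Import Order.TTheory GRing.Theory Num.Theory.
Import numFieldNormedType.Exports.

Local Open Scope classical_set_scope.
Local Open Scope ring_scope.

Section Defs.
Variable R : realType.
Variable d : nat.

Definition enorm (v : 'rV[R]_d) : R := Num.sqrt (\sum_(i < d) v 0 i ^+ 2).

Definition eball (z : 'rV[R]_d) (rho : R) : set 'rV[R]_d :=
  [set x | enorm (x - z) < rho].

(* conversion between d-tuples (carrying the product Borel sigma-algebra)
   and row vectors *)
Definition vec_of_tuple (x : d.-tuple R) : 'rV[R]_d := \row_(j < d) tnth x j.
Definition tuple_of_vec (v : 'rV[R]_d) : d.-tuple R := [tuple v 0 j | j < d].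

Fixpoint Cn (n : nat) (g : 'rV[R]_d -> R) : Prop :=
  match n with
  | 0 => continuous g
  | n'.+1 => (forall x v, derivable g x v) /\ (forall v, Cn n' ('D_v g))
  end.

Definition smooth (g : 'rV[R]_d -> R) : Prop := forall n, Cn n g.

Definition smooth_hypersurface (B : set 'rV[R]_d) : Prop :=
  forall p, B p -> exists U : set 'rV[R]_d, [/\ open U, U p &
    exists g : 'rV[R]_d -> R, [/\ smooth g, (exists v, 'D_v g p != 0) &
       B `&` U = [set x | g x = 0] `&` U]].

Variable L : nat.
Variable f : 'I_L -> 'rV[R]_d -> R.

Definition boundary (i j : 'I_L) : set 'rV[R]_d := [set x | f i x - f j x = 0].
Definition region (i j : 'I_L) : set 'rV[R]_d := [set x | f i x > f j x].

(* ||r^k_S||_2 (inf of empty set = +oo) *)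
Definition adv_dist (x0 : 'rV[R]_d) (khat k : 'I_L) (S : set 'rV[R]_d) : \bar R :=
  ereal_inf [set (enorm r)%:E | r in
    [set r | S r /\ f k (x0 + r) >= f khat (x0 + r)]].

Definition q_dir (i j : 'I_L) (p : 'rV[R]_d) : \bar R :=
  ereal_sup [set (enorm (z - p))%:E | z in
    [set z | eball z (enorm (z - p)) `<=` region i j]].

Definition q_pair (i j : 'I_L) (p : 'rV[R]_d) : \bar R :=
  mine (q_dir i j p) (q_dir j i p).

Definition q_boundary (i j : 'I_L) : \bar R :=
  ereal_inf [set q_pair i j p | p in boundary i j].

(* kappa = 1 / q, with 1/+oo = 0 (and 1/0 = +oo) *)
Definition curvature (i j : 'I_L) : \bar R := inve (q_boundary i j).

End Defs.

Section Random.
Variable R : realType.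
Variables (dT : measure_display) (T : measurableType dT).
Variable P : probability T R.
Variable d : nat.

(* X is uniformly distributed on the unit sphere S^{d-1}: measurable,
   concentrated on the sphere, and with law invariant under every orthogonal
   transformation (the uniform measure being the unique such probability). *)
Definition uniform_on_sphere (X : T -> d.-tuple R) : Prop :=
  [/\ measurable_fun setT X,
      P (X @^-1` [set x | enorm (vec_of_tuple x) = 1]) = 1%E &
      forall Q : 'M[R]_d, Q *m Q^T = 1%:M ->
        forall A : set (d.-tuple R), measurable A ->
          P (X @^-1` A) =
          P ((fun w => tuple_of_vec (vec_of_tuple (X w) *m Q)) @^-1` A)].

Definition mutually_independent (m : nat) (u : 'I_m -> T -> d.-tuple R) : Prop :=
  forall A : 'I_m -> set (d.-tuple R), (forall i, measurable (A i)) ->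
    P (\bigcap_(i in [set: 'I_m]) (u i @^-1` A i)) =
    (\prod_(i < m) P (u i @^-1` A i))%E.

Definition span_of (m : nat) (u : 'I_m -> T -> d.-tuple R) (w : T) : set 'rV[R]_d :=
  [set r | exists c : 'I_m -> R, r = \sum_(i < m) c i *: vec_of_tuple (u i w)].

End Random.

Section Zeta.
Variable R : realType.
Definition zeta1 (m : nat) (delta : R) : R :=
  (1 + 2 * Num.sqrt (ln (delta^-1) / m%:R) + 2 * ln (delta^-1) / m%:R)^-1.
Definition zeta2 (m : nat) (delta : R) : R :=
  (Num.max (expR (-1) * delta `^ (2 / m%:R))
           (1 - Num.sqrt (2 * (1 - delta `^ (2 / m%:R)))))^-1.
End Zeta.

(* Main.v *)
(** Let [p = x0 + r] be a closest point of [f k >= f khat] and [e] the unit vector along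
    [r].  The ball around [x0] of radius [rk] lies in the region of [khat], so a ball in the
    region of [k] touching it at [p] must be tangent there, hence centred on the line of [e];
    the same then holds for a ball of the region of [khat] touching [p].  The distance along a
    subspace [S] is thus squeezed between two explicit functions of the squared norm [c2] of
    the orthogonal projection of [e] on [S].

    For the law of [c2]: the joint law of the spanning vectors is invariant under a common
    orthogonal map, so [P (c2 <= b)] does not change when [e] is replaced by any vector [x],
    the event becoming [x Pi x^T <= b |x|^2].  Averaging the exponential Markov inequality over
    a Gaussian [x] gives a determinant depending only on the rank of the projection [Pi], whence
    the Beta tail bounds of Dasgupta and Gupta.  The same bound at [b = 1] shows inductively
    that the spanning vectors are almost surely independent. *)

Require Import Defs.
From HB Require Import structures.
From mathcomp Require Import all_boot all_order all_algebra.
From mathcomp Require Import all_classical all_reals all_analysis.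
From mathcomp Require Import measurable_realfun ring lra.
Import Order.TTheory GRing.Theory Num.Theory.
Import numFieldNormedType.Exports.
Local Open Scope classical_set_scope.
Local Open Scope ring_scope.

Set Implicit Arguments.
Unset Strict Implicit.
Unset Printing Implicit Defensive.

(** * Projections on row spaces *)

(** Block elimination. Evaluating one block determinant by this formula and by its mirror image
    gives [det_proj_pencil]. *)
Lemma det_schur_ul (F : fieldType) (m n : nat) (A : 'M[F]_m) (B : 'M[F]_(m, n))
    (C : 'M[F]_(n, m)) (D : 'M[F]_n) : A \in unitmx ->
  \det (block_mx A B C D) = \det A * \det (D - C *m invmx A *m B).
Proof.
move=> uA.
have -> : block_mx A B C D = block_mx 1%:M 0 (C *m invmx A) 1%:M *m
    block_mx A B 0 (D - C *m invmx A *m B).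
  rewrite mulmx_block !mul1mx !mul0mx !addr0 mulmxKV //.
  by rewrite addrC subrK.
by rewrite det_mulmx det_lblock det_ublock !det1 !mul1r.
Qed.

Lemma det_schur_dr (F : fieldType) (m n : nat) (A : 'M[F]_m) (B : 'M[F]_(m, n))
    (C : 'M[F]_(n, m)) (D : 'M[F]_n) : D \in unitmx ->
  \det (block_mx A B C D) = \det D * \det (A - B *m invmx D *m C).
Proof.
move=> uD.
have -> : block_mx A B C D = block_mx 1%:M (B *m invmx D) 0 1%:M *m
    block_mx (A - B *m invmx D *m C) 0 C D.
  rewrite mulmx_block !mul1mx !mul0mx !add0r mulmxKV //.
  by rewrite subrK.
by rewrite det_mulmx det_lblock det_ublock !det1 !mul1r mulrC.
Qed.

Definition dotv {R : realType} {d : nat} (x y : 'rV[R]_d) : R := (x *m y^T) 0 0.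
Definition qform {R : realType} {d : nat} (A : 'M[R]_d) (x : 'rV[R]_d) : R :=
  (x *m A *m x^T) 0 0.
Definition gram {R : realType} {m d : nat} (U : 'M[R]_(m, d)) : 'M[R]_m := U *m U^T.
(** The orthogonal projection on the row space, acting on row vectors from the right. This reading
    requires an invertible Gram matrix: otherwise [invmx] returns its argument. *)
Definition rowproj {R : realType} {m d : nat} (U : 'M[R]_(m, d)) : 'M[R]_d :=
  U^T *m invmx (gram U) *m U.

Section LinearAlgebra.
Context {R : realType} {d : nat}.
Implicit Types (x y : 'rV[R]_d) (A : 'M[R]_d).

Lemma dotvE x y : dotv x y = \sum_i x 0 i * y 0 i.
Proof. by rewrite /dotv !mxE; apply: eq_bigr => i _; rewrite !mxE. Qed.

Lemma dotvC x y : dotv x y = dotv y x.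
Proof. by rewrite !dotvE; apply: eq_bigr => i _; rewrite mulrC. Qed.

Lemma dotvDl x y z : dotv (x + y) z = dotv x z + dotv y z.
Proof. by rewrite /dotv mulmxDl mxE. Qed.

Lemma dotvNl x y : dotv (- x) y = - dotv x y.
Proof. by rewrite /dotv mulNmx mxE. Qed.

Lemma dotvZl a x y : dotv (a *: x) y = a * dotv x y.
Proof. by rewrite /dotv -scalemxAl mxE. Qed.

Lemma dotvDr x y z : dotv z (x + y) = dotv z x + dotv z y.
Proof. by rewrite dotvC dotvDl !(dotvC z). Qed.

Lemma dotvNr x y : dotv y (- x) = - dotv y x.
Proof. by rewrite dotvC dotvNl (dotvC y). Qed.

Lemma dotvZr a x y : dotv y (a *: x) = a * dotv y x.
Proof. by rewrite dotvC dotvZl (dotvC y). Qed.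

Lemma dotv_ge0 x : 0 <= dotv x x.
Proof. by rewrite dotvE; apply: sumr_ge0 => i _; rewrite -expr2 sqr_ge0. Qed.

Lemma dotv_eq0 x : (dotv x x == 0) = (x == 0).
Proof.
apply/eqP/eqP => [|->]; last by rewrite dotvE big1 // => i _; rewrite mxE mul0r.
rewrite dotvE => /eqP; rewrite psumr_eq0; last by move=> i _; rewrite -expr2 sqr_ge0.
move=> /allP x0; apply/rowP => i; rewrite mxE; apply/eqP.
by have := x0 i (mem_index_enum i); rewrite mulf_eq0 orbb.
Qed.

Lemma dotv_gt0 x : x != 0 -> 0 < dotv x x.
Proof. by move=> x0; rewrite lt_def dotv_eq0 x0 dotv_ge0. Qed.

Lemma dotv_mulmx A x y : dotv (x *m A) y = dotv x (y *m A^T).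
Proof. by rewrite /dotv trmx_mul trmxK mulmxA. Qed.

Lemma qformE A x : qform A x = dotv (x *m A) x.
Proof. by []. Qed.

Lemma qformD A B x : qform (A + B) x = qform A x + qform B x.
Proof. by rewrite /qform mulmxDr mulmxDl mxE. Qed.

Lemma qformZ a A x : qform (a *: A) x = a * qform A x.
Proof. by rewrite /qform -scalemxAr -scalemxAl mxE. Qed.

Lemma qform_scalar a x : qform a%:M x = a * dotv x x.
Proof. by rewrite /qform mul_mx_scalar -scalemxAl mxE. Qed.

Lemma qform_scale A a x : qform A (a *: x) = a ^+ 2 * qform A x.
Proof. by rewrite !qformE -scalemxAl dotvZl dotvZr mulrA. Qed.

Lemma enorm_sqr x : enorm x ^+ 2 = dotv x x.
Proof.
rewrite /enorm sqr_sqrtr ?sumr_ge0 // => [|i _]; last exact: sqr_ge0.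
by rewrite dotvE; apply: eq_bigr => i _; rewrite expr2.
Qed.

Lemma enorm_ge0 x : 0 <= enorm x.
Proof. exact: sqrtr_ge0. Qed.

Lemma enormE x : enorm x = Num.sqrt (dotv x x).
Proof. by rewrite -enorm_sqr sqrtr_sqr ger0_norm ?enorm_ge0. Qed.

Lemma enormZ a x : enorm (a *: x) = `|a| * enorm x.
Proof. by rewrite !enormE dotvZl dotvZr mulrA -expr2 sqrtrM ?sqr_ge0 // sqrtr_sqr. Qed.

(** Cauchy-Schwarz, from the nonnegative squared norm of [(y.y) x - (x.y) y]. *)
Lemma dotv_le_enorm x y : dotv x y <= enorm x * enorm y.
Proof.
have [->|y0] := eqVneq y 0.
  by rewrite /dotv trmx0 mulmx0 mxE mulr_ge0 ?enorm_ge0.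
apply: le_trans (ler_norm _) _.
rewrite -(ler_pXn2r (n := 2)) ?nnegrE ?mulr_ge0 ?enorm_ge0 // exprMn !enorm_sqr.
have yy := dotv_gt0 y0.
have := dotv_ge0 (dotv y y *: x - dotv x y *: y).
rewrite !(dotvDl, dotvDr, dotvNl, dotvNr, dotvZl, dotvZr) (dotvC y x).
rewrite real_normK ?num_real // => h.
rewrite -(ler_pM2l yy) -subr_ge0; apply: le_trans h _.
by rewrite le_eqVlt; apply/orP; left; apply/eqP; ring.
Qed.

(** The reflection in the hyperplane orthogonal to [x - y] exchanges two vectors of equal length. *)
Lemma exists_householder x y : dotv x x = dotv y y ->
  exists Q : 'M[R]_d, [/\ Q *m Q^T = 1%:M, Q^T = Q & x *m Q = y].
Proof.
move=> xy; have [<-|nxy] := eqVneq x y.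
  by exists 1%:M; rewrite trmx1 !mulmx1.
pose v := x - y; have v0 : v != 0 by rewrite subr_eq0.
have vv : dotv v v != 0 by rewrite dotv_eq0.
have vvT : v *m v^T = (dotv v v)%:M by rewrite [LHS]mx11_scalar.
pose Q := 1%:M - (2 / dotv v v) *: (v^T *m v).
have QT : Q^T = Q by rewrite /Q linearB /= linearZ /= trmx_mul trmxK trmx1.
exists Q; split => //.
- have PP : v^T *m v *m (v^T *m v) = dotv v v *: (v^T *m v).
    by rewrite mulmxA -(mulmxA _ v) vvT mul_mx_scalar -scalemxAl.
  rewrite QT /Q; set P := v^T *m v in PP *; set c := 2 / _.
  rewrite mulmxBr mulmx1 mulmxBl mul1mx -scalemxAl -scalemxAr PP !scalerA.
  rewrite (_ : c * c * _ = c + c); last by rewrite /c; field.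
  by rewrite scalerDl opprB addrK subrK.
- have xvT : x *m v^T = (dotv x v)%:M by rewrite [LHS]mx11_scalar.
  rewrite /Q mulmxBr mulmx1 -scalemxAr mulmxA xvT mul_scalar_mx scalerA.
  rewrite (_ : _ * _ = 1) ?scale1r; first by rewrite /v opprB addrC subrK.
  (* Equal lengths give [|x - y|^2 = 2 x.(x - y)], so the reflection subtracts exactly [x - y] from
     [x]. *)
  have vvE : dotv v v = 2 * dotv x v.
    rewrite /v !(dotvDl, dotvDr, dotvNl, dotvNr) -xy (dotvC y x); ring.
  have xv0 : dotv x v != 0 by apply: contra_neq vv; rewrite vvE => ->; rewrite mulr0.
  by rewrite vvE; field.
Qed.

End LinearAlgebra.

Section RowProjection.
Context {R : realType} {m d : nat}.
Variable U : 'M[R]_(m, d).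
Hypothesis uU : gram U \in unitmx.
Implicit Types (x : 'rV[R]_d).

Lemma gramT : (gram U)^T = gram U.
Proof. by rewrite /gram trmx_mul trmxK. Qed.

Lemma rowprojT : (rowproj U)^T = rowproj U.
Proof. by rewrite /rowproj !trmx_mul trmxK trmx_inv gramT mulmxA. Qed.

Lemma mulmx_rowproj : U *m rowproj U = U.
Proof. by rewrite /rowproj !mulmxA -/(gram U) mulmxV // mul1mx. Qed.

Lemma rowproj_id : rowproj U *m rowproj U = rowproj U.
Proof. by rewrite {1}/rowproj -mulmxA mulmx_rowproj. Qed.

Lemma qform_rowproj x : qform (rowproj U) x = dotv (x *m rowproj U) (x *m rowproj U).
Proof. by rewrite dotv_mulmx rowprojT -mulmxA rowproj_id dotvC qformE. Qed.

Lemma qform_rowproj_ge0 x : 0 <= qform (rowproj U) x.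
Proof. by rewrite qform_rowproj dotv_ge0. Qed.

Lemma qform_rowproj_le x : qform (rowproj U) x <= dotv x x.
Proof.
have := dotv_ge0 (x - x *m rowproj U).
rewrite !(dotvDl, dotvDr, dotvNl, dotvNr) -qform_rowproj (dotvC x) -qformE.
by lra.
Qed.

(** The eigenvalues of the pencil are [a] and [a + y]: with [s = |x|^2] and [q] the squared norm of
    the projection, the form is [a (s - q) + (a + y) q], where [0 <= q <= s]. *)
Lemma qform_proj_pencil_gt0 (a y : R) x : 0 < a -> 0 < a + y -> x != 0 ->
  0 < qform (a%:M + y *: rowproj U) x.
Proof.
move=> a0 ay0 /dotv_gt0 x0; rewrite qformD qformZ qform_scalar.
have := qform_rowproj_le x; have := qform_rowproj_ge0 x.
set q := qform _ _; set s := dotv x x in x0 *; rewrite le_eqVlt => /predU1P[<- _|q0 qs].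
  by rewrite mulr0 addr0 mulr_gt0.
rewrite (_ : a * s + y * q = a * (s - q) + (a + y) * q); last by ring.
by rewrite ltr_wpDl ?mulr_gt0 // mulr_ge0 ?(ltW a0) // subr_ge0.
Qed.

(** The eigenvalue [a + y] has multiplicity [m] and [a] has multiplicity [d - m]. Instead of
    diagonalising, both Schur formulas are applied to the block matrix with rows [(gram U, U)] and
    [(- y U^T, a)]. *)
Lemma det_proj_pencil (a y : R) : a != 0 ->
  \det (a%:M + y *: rowproj U) = a ^+ d * (1 + y / a) ^+ m.
Proof.
move=> a0; have ua : (a%:M : 'M[R]_d) \in unitmx.
  by rewrite unitmxE det_scalar unitrX // unitfE.
have dG : \det (gram U) != 0 by move: uU; rewrite unitmxE unitfE.
apply: (mulfI dG).
have := det_schur_ul U (- y *: U^T) a%:M uU.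
rewrite (det_schur_dr _ _ _ ua) det_scalar invmx_scalar mul_mx_scalar.
rewrite -!scalemxAl -!scalemxAr !scaleNr !opprK -/(rowproj U) => <-.
rewrite scalerN opprK scalerA -/(gram U) -{1}(scale1r (gram U)) -scalerDl.
by rewrite detZ (mulrC _ y); ring.
Qed.

Lemma rowprojM (Q : 'M[R]_d) : Q *m Q^T = 1%:M ->
  gram (U *m Q) = gram U /\ rowproj (U *m Q) = Q^T *m rowproj U *m Q.
Proof.
move=> QQ; have gE : gram (U *m Q) = gram U.
  by rewrite /gram trmx_mul mulmxA -(mulmxA U) QQ mulmx1.
by split => //; rewrite {1}/rowproj gE trmx_mul /rowproj !mulmxA.
Qed.

(** The last factor is the squared distance from [x] to the row space, so a new row keeps the Gram
    matrix invertible unless it lies in that space. *)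
Lemma det_gram_col_mx x :
  \det (gram (col_mx x U)) = \det (gram U) * (dotv x x - qform (rowproj U) x).
Proof.
rewrite {1}/gram tr_col_mx mul_col_row det_schur_dr // det_mx11; congr (_ * _).
by rewrite mxE [X in _ + X]mxE /dotv /qform /rowproj !mulmxA.
Qed.

End RowProjection.

(** * Gaussian averaging *)

Section GaussianElimination.
Context {R : realType}.

Lemma measurable_inv : measurable_fun [set: R] (@GRing.inv R).
Proof.
(* The inverse is written as [x / x^2] through the measurable [powR]; the formula also respects the
   default [0^-1 = 0]. *)
have -> : @GRing.inv R = (fun x => x * (x ^+ 2) `^ (-1)).
  apply/funext => x; have [->|x0] := eqVneq x 0; first by rewrite invr0 mul0r.
  by rewrite powR_inv1 ?sqr_ge0 //; field.
apply: measurable_funM => //; apply: (measurableT_comp (measurable_powR _)).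
exact: exprn_measurable.
Qed.

Lemma sqrtrV_powR (a : R) : 0 <= a -> (Num.sqrt a)^-1 = a `^ (- (2^-1)).
Proof. by move=> a0; rewrite powRN powR12_sqrt. Qed.

Lemma measurable_gauss_quadratic (a b c : R) :
  measurable_fun [set: R] (fun x => (expR (- (a * x ^+ 2 + 2 * b * x + c) / 2))%:E).
Proof.
apply/measurable_EFinP; apply: measurableT_comp => //; apply: measurable_funM => //.
apply: measurableT_comp => //; apply: measurable_funD => //.
apply: measurable_funD; first by apply: measurable_funM => //; exact: exprn_measurable.
exact: measurable_funM.
Qed.

Lemma measurable_qform {dT : measure_display} {T : measurableType dT} n
    (A : T -> 'M[R]_n) (y : 'rV[R]_n) :
  (forall i j, measurable_fun setT (fun w => A w i j)) ->
  measurable_fun setT (fun w => qform (A w) y).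
Proof.
move=> mA; rewrite /qform; under eq_fun do rewrite mxE.
apply: measurable_sum => i; under eq_fun do rewrite !mxE.
by apply: measurable_funM => //; apply: measurable_sum => j; exact: measurable_funM.
Qed.

(** Completing the square: up to a constant, the integrand is the normal density of mean [- b / a]
    and standard deviation [1 / sqrt a]. *)
Lemma integral_gauss_quadratic (a b c : R) : 0 < a ->
  (\int[lebesgue_measure]_x (expR (- (a * x ^+ 2 + 2 * b * x + c) / 2))%:E =
   (Num.sqrt (2 * pi) / Num.sqrt a * expR (- (c - b ^+ 2 / a) / 2))%:E)%E.
Proof.
move=> a0; set s := (Num.sqrt a)^-1.
have sa0 : 0 < Num.sqrt a by rewrite sqrtr_gt0.
have s0 : s != 0 by rewrite invr_neq0 // gt_eqF.
have s2 : s ^+ 2 = a^-1 by rewrite /s exprVn sqr_sqrtr // ltW.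
pose K := Num.sqrt (2 * pi) / Num.sqrt a * expR (- (c - b ^+ 2 / a) / 2).
have pk : normal_peak s = (Num.sqrt (2 * pi) * s)^-1.
  rewrite /normal_peak s2 (_ : _ *+ 2 = 2 * pi * a^-1); last by rewrite -mulr_natl; ring.
  by rewrite sqrtrM ?mulr_ge0 ?pi_ge0 ?sqrtrV ?(ltW a0).
have q0 : Num.sqrt (2 * pi) != 0 :> R by rewrite gt_eqF // sqrtr_gt0 mulr_gt0 ?pi_gt0.
transitivity (\int[lebesgue_measure]_x (K%:E * (normal_pdf (- b / a) s x)%:E))%E.
  apply: eq_integral => x _; rewrite -EFinM; congr EFin; rewrite normal_pdfE // pk /normal_fun s2 /K -/s.
  rewrite mulrACA mulfV ?mulf_neq0 // mul1r -expRD; congr expR.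
  by field; exact: lt0r_neq0.
rewrite ge0_integralZl_EFin //.
- by rewrite integral_normal_pdf mule1.
- by move=> x _; rewrite lee_fin normal_pdf_ge0.
- by apply/measurable_EFinP; exact: measurable_normal_pdf.
- by rewrite /K mulr_ge0 ?expR_ge0 // divr_ge0 ?sqrtr_ge0.
Qed.

Lemma qform_block n (A : 'M[R]_(1 + n)) (x : R) (y : 'rV[R]_n) : A^T = A ->
  qform A (row_mx x%:M y) =
    A 0 0 * x ^+ 2 + 2 * dotv (ursubmx A) y * x + qform (drsubmx A) y.
Proof.
move=> sA; rewrite /qform -{1}[A]submxK mul_row_block tr_row_mx mul_row_col.
have -> : dlsubmx A = (ursubmx A)^T by rewrite trmx_ursub sA.
have aE : ulsubmx A = (A 0 0)%:M.
  rewrite [LHS]mx11_scalar !mxE; congr ((A _ _)%:M); exact: val_inj.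
rewrite tr_scalar_mx mul_mx_scalar !mul_scalar_mx aE mulmxDl -scalemxAl.
have uE : (y *m (ursubmx A)^T) 0 0 = dotv (ursubmx A) y by rewrite dotvC.
rewrite /dotv; move: uE; rewrite /dotv.
move: (y *m _) (ursubmx A *m _) (y *m drsubmx A *m _) => u v w uE.
by rewrite !mxE uE !mulr1n; ring.
Qed.

Lemma dotv_row_mx n (x : R) (y : 'rV[R]_n) :
  dotv (row_mx x%:M y) (row_mx x%:M y) = x ^+ 2 + dotv y y.
Proof.
rewrite /dotv tr_row_mx mul_row_col mxE tr_scalar_mx mul_scalar_mx; congr (_ + _).
by rewrite !mxE mulr1n expr2.
Qed.

Definition schur n (A : 'M[R]_(1 + n)) : 'M[R]_n :=
  drsubmx A - (A 0 0)^-1 *: ((ursubmx A)^T *m ursubmx A).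

Lemma schurE n (A : 'M[R]_(1 + n)) i j :
  schur A i j = A (rshift 1 i) (rshift 1 j)
    - (A 0 0)^-1 * (A 0 (rshift 1 i) * A 0 (rshift 1 j)).
Proof.
rewrite !mxE big_ord1 !mxE; congr (_ - _ * (A _ _ * A _ _)); exact: val_inj.
Qed.

(** This is the constant [c - b^2 / a] that [integral_gauss_quadratic] leaves once the first
    coordinate is integrated out, with the coefficients read off from [qform_block]. *)
Lemma qform_schur n (A : 'M[R]_(1 + n)) (y : 'rV[R]_n) :
  qform (schur A) y = qform (drsubmx A) y - dotv (ursubmx A) y ^+ 2 / A 0 0.
Proof.
rewrite /schur -scaleNr qformD qformZ mulNr; congr (_ - _); rewrite mulrC; congr (_ / _).
rewrite /qform mulmxA -mulmxA mxE big_ord1 expr2; congr (_ * _).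
by rewrite -/(dotv y (ursubmx A)) dotvC.
Qed.

Lemma schurT n (A : 'M[R]_(1 + n)) : A^T = A -> (schur A)^T = schur A.
Proof.
move=> sA; rewrite /schur linearB /= linearZ /= trmx_mul trmxK; congr (_ - _).
by rewrite trmx_drsub sA.
Qed.

Lemma det_schur n (A : 'M[R]_(1 + n)) : A^T = A -> A 0 0 != 0 ->
  \det A = A 0 0 * \det (schur A).
Proof.
move=> sA a0; rewrite -{1}[A]submxK.
have aE : ulsubmx A = (A 0 0)%:M.
  rewrite [LHS]mx11_scalar !mxE; congr ((A _ _)%:M); exact: val_inj.
have uA : ulsubmx A \in unitmx by rewrite aE unitmxE det_scalar1 unitfE.
rewrite det_schur_ul // aE det_scalar1; congr (_ * \det (_ - _)).
have -> : dlsubmx A = (ursubmx A)^T by rewrite trmx_ursub sA.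
by rewrite invmx_scalar mul_mx_scalar -scalemxAl.
Qed.

Definition posdef n (A : 'M[R]_n) := forall x, x != 0 -> 0 < qform A x.

Lemma posdef_pivot n (A : 'M[R]_(1 + n)) : A^T = A -> posdef A -> 0 < A 0 0.
Proof.
move=> sA pA; have := pA (row_mx 1%:M 0).
rewrite qform_block // expr1n mulr1 /dotv trmx0 mulmx0 mxE mulr0 mul0r addr0.
rewrite /qform trmx0 mulmx0 mxE addr0; apply.
by apply/eqP => /rowP /(_ (lshift n 0)); rewrite row_mxEl !mxE => /eqP; rewrite oner_eq0.
Qed.

Lemma posdef_schur n (A : 'M[R]_(1 + n)) : A^T = A -> posdef A -> posdef (schur A).
Proof.
move=> sA pA y y0; have a0 := posdef_pivot sA pA.
(* This first coordinate minimises the form for the given [y], and the minimum is the Schur form. *)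
have := pA (row_mx (- dotv (ursubmx A) y / A 0 0)%:M y).
rewrite qform_block // qform_schur => h.
have {}h := h _; apply: lt_le_trans (h _) _; last first.
  by rewrite le_eqVlt; apply/orP; left; apply/eqP; field; exact: lt0r_neq0.
apply: contra_neq y0 => /eqP; rewrite row_mx_eq0 => /andP[_ /eqP //].
Qed.

Context {dT : measure_display} {T : measurableType dT} (P : probability T R).

(* Integrates the hypothesis against one coordinate of [x] at a time, each step being
   a one-dimensional Gaussian integral that replaces [A] by its Schur complement. *)
Lemma gaussian_average_le n (A : T -> 'M[R]_n) (g : T -> R) (p : R) :
  (forall i j, measurable_fun setT (fun w => A w i j)) -> measurable_fun setT g ->
  (forall w, 0 <= g w) -> (forall w, (A w)^T = A w) -> (forall w, posdef (A w)) ->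
  0 <= p ->
  (forall x : 'rV[R]_n, ((p * expR (- dotv x x / 2))%:E <=
     \int[P]_w (g w * expR (- qform (A w) x / 2))%:E)%E) ->
  (p%:E <= \int[P]_w (g w / Num.sqrt (\det (A w)))%:E)%E.
Proof.
elim: n A g => [|n IH] A g mA mg g0 sA pA p0 h.
  have := h 0; rewrite /dotv trmx0 mulmx0 mxE oppr0 mul0r expR0 mulr1 => /le_trans; apply.
  rewrite le_eqVlt; apply/orP; left; apply/eqP; apply: eq_integral => w _.
  by rewrite /qform trmx0 mulmx0 mxE oppr0 mul0r expR0 det_mx00 sqrtr1 divr1 mulr1.
pose a w := A w 0 0; pose S w := schur (A w : 'M[R]_(1 + n)).
have a0 w : 0 < a w by exact: posdef_pivot (sA w) (pA w).
(* The weight absorbs the factor produced by integrating the first coordinate; [det_schur]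
   recombines the pivots into the determinant. *)
pose g' w := g w / Num.sqrt (a w).
have mg' : measurable_fun setT g'.
  have -> : g' = (fun w => g w * powR (a w) (- 2^-1)).
    by apply/funext => w; rewrite /g' sqrtrV_powR // ltW.
  by apply: measurable_funM => //; apply: (measurableT_comp (measurable_powR _)); exact: mA.
have mS i j : measurable_fun setT (fun w => S w i j).
  under eq_fun do rewrite /S schurE.
  apply: measurable_funB; first exact: mA.
  apply: measurable_funM; last by apply: measurable_funM; exact: mA.
  by apply: (measurableT_comp measurable_inv); exact: mA.
have := IH S g' mS mg' _ _ _ p0 _; move=> {}IH.
rewrite (_ : (fun w => _) = (fun w => (g' w / Num.sqrt (\det (S w)))%:E)); last first.
  apply/funext => w; congr EFin; rewrite (@det_schur n) ?(gt_eqF (a0 w)) //.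
  by rewrite sqrtrM ?(ltW (a0 w)) // invfM mulrA.
apply: IH.
- by move=> w; rewrite divr_ge0 ?sqrtr_ge0.
- by move=> w; exact: schurT.
- by move=> w; exact: posdef_schur.
move=> y.
pose F (z : R * T) : \bar R :=
  (g z.2 * expR (- (a z.2 * z.1 ^+ 2 + 2 * dotv (ursubmx (A z.2 : 'M[R]_(1 + n))) y * z.1
     + qform (drsubmx (A z.2 : 'M[R]_(1 + n))) y) / 2))%:E.
have mF : measurable_fun setT F.
  apply/measurable_EFinP; apply: measurable_funM; first exact: measurableT_comp.
  apply: measurableT_comp => //; apply: measurable_funM => //.
  have m2 i j : measurable_fun setT (fun z : R * T => A z.2 i j).
    by apply: (measurableT_comp (mA i j)).
  apply: measurableT_comp => //; apply: measurable_funD; last first.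
    by apply: measurable_qform => i j; under eq_fun do rewrite !mxE; exact: m2.
  apply: measurable_funD; apply: measurable_funM => //; first exact: m2.
    by apply: measurable_funX.
  apply: measurable_funM => //; under eq_fun do rewrite dotvE.
  apply: measurable_sum => i; apply: measurable_funM => //.
  by under eq_fun do rewrite !mxE; exact: m2.
have F0 z : (0 <= F z)%E by rewrite lee_fin mulr_ge0 ?expR_ge0.
have s2pi : 0 < Num.sqrt (2 * pi) :> R by rewrite sqrtr_gt0 mulr_gt0 ?pi_gt0.
(* The hypothesis at [row_mx x y] is integrated over [x]. After Tonelli both sides carry the factor
   [sqrt (2 pi)], which cancels. *)
have step : (\int[lebesgue_measure]_x (p * expR (- (x ^+ 2 + dotv y y) / 2))%:E <=
    \int[lebesgue_measure]_x \int[P]_w F (x, w))%E.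
  apply: ge0_le_integral => //.
  - by move=> x _; rewrite lee_fin mulr_ge0 ?expR_ge0.
  - apply/measurable_EFinP; apply: measurable_funM => //; apply: measurableT_comp => //.
    apply: measurable_funM => //; apply: measurableT_comp => //.
    by apply: measurable_funD => //; exact: exprn_measurable.
  - exact: measurable_fun_fubini_tonelli_F.
  - move=> x _; rewrite -dotv_row_mx; apply: le_trans (h _) _.
    rewrite le_eqVlt; apply/orP; left; apply/eqP; apply: eq_integral => w _.
    by rewrite /F /= (@qform_block n).
have gaussP : (\int[lebesgue_measure]_x (p * expR (- (x ^+ 2 + dotv y y) / 2))%:E =
    (Num.sqrt (2 * pi) * (p * expR (- dotv y y / 2)))%:E)%E.
  transitivity (\int[lebesgue_measure]_x
      (p%:E * (expR (- (1 * x ^+ 2 + 2 * 0 * x + dotv y y) / 2))%:E))%E.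
    by apply: eq_integral => x _; rewrite -EFinM mul1r mulr0 mul0r addr0.
  rewrite ge0_integralZl_EFin //.
  - rewrite integral_gauss_quadratic // -EFinM sqrtr1 expr0n /= mul0r subr0 divr1.
    by rewrite mulrCA.
  - exact: measurable_gauss_quadratic.
have gaussF w : (\int[lebesgue_measure]_x F (x, w) =
    (Num.sqrt (2 * pi))%:E * (g' w * expR (- qform (S w) y / 2))%:E)%E.
  rewrite /F /=; under eq_integral do rewrite EFinM.
  rewrite ge0_integralZl_EFin //.
  - rewrite integral_gauss_quadratic // -!EFinM /S qform_schur; congr EFin.
    by rewrite /g' /a; ring.
  - exact: measurable_gauss_quadratic.
move: step; rewrite gaussP fubini_tonelli //.
under [X in (_ <= X)%E]eq_integral do rewrite gaussF.
rewrite ge0_integralZl_EFin ?(ltW s2pi) //.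
- by rewrite EFinM lee_pmul2l // lte_fin.
- by move=> w _; rewrite lee_fin mulr_ge0 ?expR_ge0 // divr_ge0 ?sqrtr_ge0.
- apply/measurable_EFinP; apply: measurable_funM => //; apply: measurableT_comp => //.
  apply: measurable_funM => //; apply: measurableT_comp => //; exact: measurable_qform.
Qed.

End GaussianElimination.

(** * Random matrices and laws of tuples *)

Section MeasurableMatrix.
Context {R : realType} {dT : measure_display} {T : measurableType dT}.

Definition measurable_mx m n (A : T -> 'M[R]_(m, n)) :=
  forall i j, measurable_fun setT (fun w => A w i j).

Lemma measurable_mx_tr m n (A : T -> 'M[R]_(m, n)) :
  measurable_mx A -> measurable_mx (fun w => (A w)^T).
Proof. by move=> mA i j; under eq_fun do rewrite mxE; exact: mA. Qed.

Lemma measurable_mx_mul m n p (A : T -> 'M[R]_(m, n)) (B : T -> 'M[R]_(n, p)) :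
  measurable_mx A -> measurable_mx B -> measurable_mx (fun w => A w *m B w).
Proof.
move=> mA mB i j; under eq_fun do rewrite mxE.
by apply: measurable_sum => k; apply: measurable_funM; [exact: mA|exact: mB].
Qed.

Lemma measurable_mx_det n (A : T -> 'M[R]_n) :
  measurable_mx A -> measurable_fun setT (fun w => \det (A w)).
Proof.
move=> mA; rewrite /determinant.
apply: measurable_sum => s; apply: measurable_funM => //.
by apply: measurable_prod => i _; exact: mA.
Qed.

Lemma measurable_mx_unit n (A : T -> 'M[R]_n) :
  measurable_mx A -> measurable_fun setT (fun w => A w \in unitmx).
Proof.
move=> mA; under eq_fun do rewrite unitmxE unitfE.
apply: measurable_neg.
by apply: measurable_fun_eqr => //; exact: measurable_mx_det.
Qed.

Lemma measurable_mx_inv n (A : T -> 'M[R]_n) :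
  measurable_mx A -> measurable_mx (fun w => invmx (A w)).
Proof.
move=> mA i j.
(* Cofactor formula on the invertible matrices, the default value [A w] elsewhere. *)
have -> : (fun w => invmx (A w) i j) = (fun w => if A w \in unitmx then
    (\det (A w))^-1 * cofactor (A w) j i else A w i j).
  by apply/funext => w; rewrite /invmx; case: ifP => _; rewrite ?mxE.
apply: measurable_fun_ifT; [exact: measurable_mx_unit| |exact: mA].
apply: measurable_funM.
  by apply: (measurableT_comp (@measurable_inv R)); exact: measurable_mx_det.
rewrite /cofactor; apply: measurable_funM => //; apply: measurable_mx_det => k l.
by under eq_fun do rewrite !mxE; exact: mA.
Qed.

Lemma measurable_mx_gram m d (U : T -> 'M[R]_(m, d)) :
  measurable_mx U -> measurable_mx (fun w => gram (U w)).
Proof. by move=> mU; apply: measurable_mx_mul => //; exact: measurable_mx_tr. Qed.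

Lemma measurable_mx_rowproj m d (U : T -> 'M[R]_(m, d)) :
  measurable_mx U -> measurable_mx (fun w => rowproj (U w)).
Proof.
move=> mU; do 2?apply: measurable_mx_mul => //; first exact: measurable_mx_tr.
by apply: measurable_mx_inv; exact: measurable_mx_gram.
Qed.

End MeasurableMatrix.

Definition box {n} {Y : Type} (A : 'I_n -> set Y) : set (n.-tuple Y) :=
  [set t | forall i, A i (tnth t i)].

Section TupleLaw.
Context {R : realType} {dY : measure_display} {Y : measurableType dY} {n : nat}.

Lemma measurable_box (A : 'I_n -> set Y) :
  (forall i, measurable (A i)) -> measurable (box A).
Proof.
move=> mA; have -> : box A = \bigcap_(i in [set: 'I_n]) ((fun t => tnth t i) @^-1` A i).
  by apply/seteqP; split => [t At i _|t At i]; [exact: At|exact: (At i I)].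
apply: fin_bigcap_measurable; first exact: finite_finset.
by move=> i _; rewrite -[X in measurable X]setTI; exact: measurable_tnth.
Qed.

(** The product sigma-algebra is generated by one-coordinate cylinders, and each of these is a box
    whose other sides are full. *)
Lemma measurable_tuple_box :
  @measurable _ (n.-tuple Y) =
  <<s [set B | exists2 A : 'I_n -> set Y, (forall i, measurable (A i)) & B = box A] >>.
Proof.
apply/seteqP; split; last first.
  by apply: smallest_sub; [exact: sigma_algebra_measurable|move=> _ [A mA ->]; exact: measurable_box].
apply: smallest_sub; first exact: smallest_sigma_algebra.
move=> B; rewrite -bigcup_seq => -[i _ [A mA <-]]; apply: sub_sigma_algebra.
exists (fun j => if j == i then A else setT); first by move=> j; case: ifP.
rewrite setTI; apply/seteqP; split => [t At j|t /(_ i)]; last by rewrite eqxx.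
by case: eqVneq => [->|].
Qed.

Context {d1 d2 : measure_display} {T1 : measurableType d1} {T2 : measurableType d2}.

(** Boxes form a generating pi-system that contains the whole space, and the measure is finite.
    Independence speaks of boxes only, so this extension carries it to all events. *)
Lemma tuple_law_unique (P1 : {measure set T1 -> \bar R}) (P2 : {measure set T2 -> \bar R})
    (f1 : T1 -> n.-tuple Y) (f2 : T2 -> n.-tuple Y) :
  (P1 setT < +oo)%E ->
  measurable_fun setT f1 -> measurable_fun setT f2 ->
  (forall A : 'I_n -> set Y, (forall i, measurable (A i)) ->
     P1 (f1 @^-1` box A) = P2 (f2 @^-1` box A)) ->
  forall B, measurable B -> P1 (f1 @^-1` B) = P2 (f2 @^-1` B).
Proof.
move=> P1oo mf1 mf2 boxE B mB.
pose m1 : {measure set (n.-tuple Y) -> \bar R} :=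
  measure_function_pushforward__canonical__measure_function_Measure P1 mf1.
pose m2 : {measure set (n.-tuple Y) -> \bar R} :=
  measure_function_pushforward__canonical__measure_function_Measure P2 mf2.
apply: (@measure_unique _ _ _ _ (fun=> setT) measurable_tuple_box _ _ _ m1 m2) => //.
- move=> _ _ [A mA ->] [A' mA' ->]; exists (fun i => A i `&` A' i).
    by move=> i; exact: measurableI.
  apply/seteqP; split => [t [At A't] i|t h]; first by split; [exact: At|exact: A't].
  by split => i; have [] := h i.
- move=> _; exists (fun=> setT) => //.
  by apply/seteqP; split.
- by rewrite bigcup_const.
- by move=> _ [A mA ->]; exact: boxE.
Qed.

End TupleLaw.

(** * Projection on a random subspace *)

Section RandomSubspace.
Context {R : realType} {d : nat} {dT : measure_display} {T : measurableType dT}.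
Variable P : probability T R.

Definition joint {Y : Type} {n} (u : 'I_n -> T -> Y) (w : T) : n.-tuple Y :=
  [tuple u i w | i < n].

Definition mx_of_tuples {n} (t : n.-tuple (d.-tuple R)) : 'M[R]_(n, d) :=
  \matrix_(i, j) tnth (tnth t i) j.

Definition rotate (Q : 'M[R]_d) (x : d.-tuple R) : d.-tuple R :=
  tuple_of_vec (vec_of_tuple x *m Q).

Lemma tnth_rotate Q x j : tnth (rotate Q x) j = \sum_k tnth x k * Q k j.
Proof. by rewrite tnth_mktuple !mxE; apply: eq_bigr => k _; rewrite mxE. Qed.

Lemma measurable_rotate Q : measurable_fun setT (rotate Q).
Proof.
apply/measurable_fun_tnthP => j; rewrite /comp.
under eq_fun do rewrite tnth_rotate.
by apply: measurable_sum => k; apply: measurable_funM => //; exact: measurable_tnth.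
Qed.

Lemma measurable_joint {dY : measure_display} {Y : measurableType dY} n
    (u : 'I_n -> T -> Y) :
  (forall i, measurable_fun setT (u i)) -> measurable_fun setT (joint u).
Proof.
move=> mu; apply/measurable_fun_tnthP => i; rewrite /comp.
by under eq_fun do rewrite tnth_mktuple; exact: mu.
Qed.

Lemma preimage_joint_box {Y : Type} n (u : 'I_n -> T -> Y) A :
  joint u @^-1` box A = \bigcap_(i in [set: 'I_n]) (u i @^-1` A i).
Proof.
apply/seteqP; split => [w h i _|w h i]; first by have := h i; rewrite tnth_mktuple.
by rewrite tnth_mktuple; exact: h.
Qed.

Lemma measurable_mx_of_tuples n : measurable_mx (@mx_of_tuples n).
Proof.
move=> i j; under eq_fun do rewrite mxE.
exact: (measurableT_comp (measurable_tnth j) (measurable_tnth i)).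
Qed.

Lemma mx_of_tuples_rotate n (u : 'I_n -> T -> d.-tuple R) Q w :
  mx_of_tuples (joint (fun i => rotate Q \o u i) w) = mx_of_tuples (joint u w) *m Q.
Proof.
apply/matrixP => i j; rewrite !mxE tnth_mktuple /= tnth_rotate.
by apply: eq_bigr => k _; rewrite mxE tnth_mktuple.
Qed.

Variable n : nat.
Variable u : 'I_n -> T -> d.-tuple R.
Hypothesis unif_u : forall i, uniform_on_sphere P (u i).
Hypothesis indep_u : mutually_independent P u.

Let mu i : measurable_fun setT (u i).
Proof. by have [] := unif_u i. Qed.

(** On a box, independence factors the probability, each factor is invariant under [Q], and
    independence applied to the rotated sides reassembles the product. *)
Lemma joint_law_rotate Q B : Q *m Q^T = 1%:M -> measurable B ->
  P (joint u @^-1` B) = P (joint (fun i => rotate Q \o u i) @^-1` B).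
Proof.
move=> QQ; apply: (tuple_law_unique (P1 := P) (P2 := P)).
- by rewrite [X in (X < _)%E]probability_setT ltry.
- exact: measurable_joint.
- by apply: measurable_joint => i; apply: measurableT_comp => //; exact: measurable_rotate.
move=> A mA; rewrite !preimage_joint_box.
have mQA i : measurable (rotate Q @^-1` A i).
  by rewrite -[X in measurable X]setTI; exact: measurable_rotate.
transitivity (\prod_(i < n) P (u i @^-1` (rotate Q @^-1` A i)))%E.
  rewrite [LHS](indep_u mA).
  by apply: eq_bigr => i _; have [_ _ /(_ Q QQ (A i) (mA i))] := unif_u i.
exact/esym/(indep_u mQA).
Qed.

Local Notation U w := (mx_of_tuples (joint u w)).

Lemma measurable_mx_joint : measurable_mx (fun w => U w).
Proof.
move=> i j; apply: (measurableT_comp (measurable_mx_of_tuples i j)).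
exact: measurable_joint.
Qed.

(** The sign of [y] selects the tail: the quadratic form is at most [b |x|^2] for [y > 0] and at
    least [b |x|^2] for [y < 0]. The size of a nonzero [y] does not affect the event, so it is free
    to serve as the exponent of a Chernoff bound. *)
Definition proj_event (b y : R) (x : 'rV[R]_d) : set (n.-tuple (d.-tuple R)) :=
  [set t | (gram (mx_of_tuples t) \in unitmx) &&
     (0 <= y * (b * dotv x x - qform (rowproj (mx_of_tuples t)) x))].

Lemma measurable_proj_event b y x : measurable (proj_event b y x).
Proof.
rewrite /proj_event -[X in measurable X]setTI.
have mp : measurable_fun setT (fun t : n.-tuple (d.-tuple R) =>
    (gram (mx_of_tuples t) \in unitmx) &&
    (0 <= y * (b * dotv x x - qform (rowproj (mx_of_tuples t)) x))).
  apply: measurable_and.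
    by apply: measurable_mx_unit; apply: measurable_mx_gram; exact: measurable_mx_of_tuples.
  apply: measurable_fun_ler => //; apply: measurable_funM => //.
  apply: measurable_funB => //; apply: measurable_qform.
  by apply: measurable_mx_rowproj; exact: measurable_mx_of_tuples.
have -> : [set t : n.-tuple (d.-tuple R) | (gram (mx_of_tuples t) \in unitmx) &&
    (0 <= y * (b * dotv x x - qform (rowproj (mx_of_tuples t)) x))] =
  (fun t => (gram (mx_of_tuples t) \in unitmx) &&
    (0 <= y * (b * dotv x x - qform (rowproj (mx_of_tuples t)) x))) @^-1` [set true].
  by apply/seteqP; split => t /= ->.
exact: mp.
Qed.

(** A reflection carries [e] to the direction of [x], and the defining inequality is homogeneous of
    degree two in the vector. *)
Lemma proj_event_law b y (e x : 'rV[R]_d) : dotv e e = 1 -> x != 0 ->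
  P (joint u @^-1` proj_event b y e) = P (joint u @^-1` proj_event b y x).
Proof.
move=> e1 x0; have xx := dotv_gt0 x0.
have r0 : 0 < enorm x by rewrite enormE sqrtr_gt0.
have [|Q [QQ QT eQ]] := @exists_householder _ _ e ((enorm x)^-1 *: x).
  by rewrite e1 dotvZl dotvZr -enorm_sqr; field; exact: lt0r_neq0.
rewrite (joint_law_rotate QQ (measurable_proj_event _ _ _)); congr (P _).
apply/seteqP; rewrite /proj_event /preimage.
suff h w : ((gram (mx_of_tuples (joint (fun i => rotate Q \o u i) w)) \in unitmx) &&
     (0 <= y * (b * dotv e e -
        qform (rowproj (mx_of_tuples (joint (fun i => rotate Q \o u i) w))) e))) =
    ((gram (U w) \in unitmx) && (0 <= y * (b * dotv x x - qform (rowproj (U w)) x))).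
  by split => w /=; rewrite h.
rewrite mx_of_tuples_rotate; have [-> ->] := rowprojM (U w) QQ; congr (_ && _).
move: (rowproj (U w)) => Pi; rewrite {1}/qform QT !mulmxA eQ -mulmxA.
have -> : Q *m e^T = ((enorm x)^-1 *: x)^T by rewrite -eQ trmx_mul QT.
rewrite -/(qform Pi ((enorm x)^-1 *: x)) qform_scale e1 -enorm_sqr exprVn.
rewrite [in RHS](_ : _ * (_ - _) =
    enorm x ^+ 2 * (y * (b * 1 - (enorm x ^+ 2)^-1 * qform Pi x))).
  by rewrite [in RHS]pmulr_rge0 ?exprn_gt0.
by field; exact: lt0r_neq0.
Qed.

(** For each fixed [x], Markov's inequality bounds the probability times [exp (- |x|^2 / 2)] by the
    mean of a Gaussian weight with matrix [a + y Pi], where [a = 1 - y b]. Averaging over [x] turns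
    this mean into [det ^ (- 1/2)], which is the same for all full-rank samples. The two positivity
    hypotheses make the matrix positive definite. *)
Lemma proj_chernoff b y (e : 'rV[R]_d) : dotv e e = 1 ->
  0 < 1 - y * b -> 0 < 1 - y * b + y ->
  (P (joint u @^-1` proj_event b y e) <=
   ((Num.sqrt ((1 - y * b) ^+ d * (1 + y / (1 - y * b)) ^+ n))^-1)%:E)%E.
Proof.
move=> e1 a0 ay0; set a := 1 - y * b in a0 ay0 *.
set c := a ^+ d * _; set E := joint u @^-1` _.
have mjoint := measurable_joint mu.
have mE x : measurable (joint u @^-1` proj_event b y x).
  by rewrite -[X in measurable X]setTI; apply: mjoint => //; exact: measurable_proj_event.
have PEfin : P E \is a fin_num by apply: fin_num_measure; exact: mE.
pose p := fine (P E); have pE : P E = p%:E by rewrite fineK.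
have p0 : 0 <= p by rewrite -lee_fin -pE.
pose good w := gram (U w) \in unitmx.
have mgood : measurable_fun setT good.
  by apply: measurable_mx_unit; apply: measurable_mx_gram; exact: measurable_mx_joint.
pose g w : R := if good w then 1 else 0.
(* The identity keeps [A] positive definite where the Gram matrix is singular; there the weight [g]
   vanishes. *)
pose A w : 'M[R]_d := if good w then a%:M + y *: rowproj (U w) else 1%:M.
have mg : measurable_fun setT g by exact: measurable_fun_ifT.
have mA i j : measurable_fun setT (fun w => A w i j).
  have -> : (fun w => A w i j) = (fun w => if good w then
      a *+ (i == j) + y * rowproj (U w) i j else (i == j)%:R).
    by apply/funext => w; rewrite /A; case: ifP => _; rewrite !mxE.
  apply: measurable_fun_ifT => //; apply: measurable_funD => //.
  by apply: measurable_funM => //; apply: measurable_mx_rowproj; exact: measurable_mx_joint.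
have g0 w : 0 <= g w by rewrite /g; case: ifP.
have sA w : (A w)^T = A w.
  rewrite /A; case: ifP => _; last exact: trmx1.
  by rewrite linearD /= linearZ /= tr_scalar_mx rowprojT.
have pA w : posdef (A w).
  rewrite /A; case: ifP => gw x x0; first exact: qform_proj_pencil_gt0.
  by rewrite qform_scalar mul1r dotv_gt0.
have pEx x : (p%:E <= P (joint u @^-1` proj_event b y x))%E.
  have [->|x0] := eqVneq x 0; last by rewrite -(proj_event_law _ _ e1 x0) -pE.
  rewrite -pE; apply: le_measure; rewrite ?inE; [exact: mE|exact: mE|].
  move=> w /andP[gw _]; rewrite /preimage /proj_event /= gw /=.
  by rewrite /qform /dotv trmx0 !mulmx0 mxE mulr0 subr0 mulr0.
have fE : (fun w => (g w / Num.sqrt (\det (A w)))%:E) = (fun w => (g w / Num.sqrt c)%:E).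
  apply/funext => w; congr EFin; rewrite /g /A; case: ifP => [gw|]; last by rewrite !mul0r.
  by rewrite det_proj_pencil // gt_eqF.
rewrite pE; apply: (@le_trans _ _ (\int[P]_w (g w / Num.sqrt (\det (A w)))%:E)%E).
  apply: gaussian_average_le => // x; set k := expR _.
  have k0 : 0 <= k by exact: expR_ge0.
  apply: (@le_trans _ _ (k%:E * P (joint u @^-1` proj_event b y x))%E).
    by rewrite mulrC EFinM; apply: lee_wpmul2l; rewrite ?lee_fin.
  rewrite -integral_cst //.
  have mf : measurable_fun setT (fun w => (g w * expR (- qform (A w) x / 2))%:E).
    apply/measurable_EFinP; apply: measurable_funM => //; apply: measurableT_comp => //.
    by apply: measurable_funM => //; apply: measurableT_comp => //; exact: measurable_qform.
  apply: (@le_trans _ _ (\int[P]_(w in joint u @^-1` proj_event b y x)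
      (g w * expR (- qform (A w) x / 2))%:E)%E); last first.
    apply: ge0_subset_integral => //.
    by move=> w _; rewrite lee_fin mulr_ge0 ?expR_ge0.
  apply: ge0_le_integral => //.
    exact: measurable_funTS.
  (* On the event, [a |x|^2 + y q <= |x|^2], with [q] the value of the projection form; this is the
     defining inequality rearranged. *)
  move=> w /andP[gw h]; rewrite lee_fin /g /A /good gw mul1r ler_expR.
  rewrite ler_pM2r // lerN2 qformD qformZ qform_scalar /a.
  by rewrite -subr_ge0; apply: le_trans h _; rewrite le_eqVlt; apply/orP; left; apply/eqP; ring.
rewrite fE; apply: (@le_trans _ _ (\int[P]_w ((Num.sqrt c)^-1)%:E)%E).
  apply: ge0_le_integral => //.
  - by move=> w _; rewrite lee_fin divr_ge0 ?sqrtr_ge0.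
  - by apply/measurable_EFinP; apply: measurable_funM.
  - move=> w _; rewrite lee_fin /g; case: ifP => _; first by rewrite mul1r.
    by rewrite mul0r invr_ge0 sqrtr_ge0.
by rewrite integral_cst // [X in (_ * X)%E]probability_setT mule1.
Qed.

End RandomSubspace.

(** * Almost sure linear independence of the spanning vectors *)

Section FullRank.
Context {R : realType} {d : nat} {dT : measure_display} {T : measurableType dT}.
Variable P : probability T R.

Definition singular {n} : set (n.-tuple (d.-tuple R)) :=
  [set t | gram (mx_of_tuples t) \notin unitmx].

Lemma measurable_singular n : measurable (@singular n).
Proof.
have m : measurable_fun setT (fun t : n.-tuple (d.-tuple R) =>
    gram (mx_of_tuples t) \in unitmx).
  by apply: measurable_mx_unit; apply: measurable_mx_gram; exact: measurable_mx_of_tuples.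
have -> : @singular n = (fun t => gram (mx_of_tuples t) \in unitmx) @^-1` [set false].
  by apply/seteqP; split => t /=; [move/negPf|move=> h; rewrite /singular /= h].
by rewrite -[X in measurable X]setTI; exact: m.
Qed.

Definition tsphere : set (d.-tuple R) := [set x | dotv (vec_of_tuple x) (vec_of_tuple x) == 1].

Lemma measurable_tsphere : measurable tsphere.
Proof.
have m : measurable_fun setT (fun x : d.-tuple R =>
    dotv (vec_of_tuple x) (vec_of_tuple x) == 1).
  apply: measurable_fun_eqr => //; under eq_fun do rewrite dotvE.
  apply: measurable_sum => i; under eq_fun do rewrite !mxE.
  by apply: measurable_funM; exact: measurable_tnth.
have -> : tsphere = (fun x => dotv (vec_of_tuple x) (vec_of_tuple x) == 1) @^-1` [set true].
  by apply/seteqP; split => t /=.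
by rewrite -[X in measurable X]setTI; exact: m.
Qed.

Lemma uniform_tsphere (X : T -> d.-tuple R) :
  uniform_on_sphere P X -> P (X @^-1` ~` tsphere) = 0%E.
Proof.
case=> mX PX _; rewrite preimage_setC probability_setC; last first.
  by rewrite -[X in measurable X]setTI; exact: (mX measurableT _ measurable_tsphere).
rewrite [X in (1 - X)%E](_ : _ = 1%E) ?subee //.
rewrite -[RHS]PX; congr (P _).
apply/seteqP; split => w /=; rewrite /tsphere /= enormE.
  by move=> /eqP ->; rewrite sqrtr1.
by move=> h; rewrite -enorm_sqr enormE h expr1n.
Qed.

(** The event says that [e] lies in the row space. It is unchanged when the exponent [-1] becomes
    [- s] with [s > 0], and the Chernoff bound is then [(1 + s) ^ (- (d - n) / 2)], which tends to
    [0] because [n < d]. *)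
Lemma proj_full_null n (u : 'I_n -> T -> d.-tuple R) (e : 'rV[R]_d) :
  (n < d)%N -> (forall i, uniform_on_sphere P (u i)) -> mutually_independent P u ->
  dotv e e = 1 -> P (joint u @^-1` proj_event 1 (-1) e) = 0%E.
Proof.
move=> nd unif indep e1; set E := _ @^-1` _.
have sE (s : R) : 0 < s -> E = joint u @^-1` proj_event 1 (- s) e.
  move=> s0; rewrite /E /preimage /proj_event; apply/seteqP; split=> w /=;
  by rewrite !mulNr !oppr_ge0 !mul1r pmulr_rle0.
have bnd (s : R) : 0 < s -> (P E <= ((Num.sqrt (1 + s))^-1)%:E)%E.
  move=> s0; rewrite (sE s s0); apply: le_trans (proj_chernoff unif indep e1 _ _) _;
    rewrite ?mulNr ?mulr1 ?opprK; [lra|lra|].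
  have s1 : 0 < 1 + s by lra.
  rewrite (_ : 1 - s / (1 + s) = (1 + s)^-1); last by field; exact: lt0r_neq0.
  rewrite exprVn -expfB // lee_fin lef_pV2 ?posrE ?sqrtr_gt0 ?exprn_gt0 //.
  rewrite ler_wsqrtr // -{1}(expr1 (1 + s)) ler_weXn2l ?subn_gt0 //.
  by lra.
apply/eqP; rewrite eq_le measure_ge0 andbT.
apply/lee_addgt0Pr => eps eps0; rewrite add0e.
(* The choice [s = eps ^- 2] makes [1 / sqrt (1 + s)] at most [eps]. *)
apply: le_trans (bnd (eps ^- 2) _) _; first by rewrite invr_gt0 exprn_gt0.
rewrite lee_fin invf_ple ?posrE ?sqrtr_gt0 //; last first.
  by rewrite addr_gt0 // invr_gt0 exprn_gt0.
apply: (@le_trans _ _ (Num.sqrt (eps ^- 2))); last first.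
  by rewrite ler_wsqrtr // lerDr.
by rewrite -exprVn sqrtr_sqr ler_norm.
Qed.

Lemma mutually_independent_behead n (u : 'I_n.+1 -> T -> d.-tuple R) :
  mutually_independent P u -> mutually_independent P (fun i => u (lift ord0 i)).
Proof.
move=> indep A mA.
have := indep (fun i => if unlift ord0 i is Some j then A j else setT).
rewrite big_ord_recl unlift_none preimage_setT [X in (X * _)%E]probability_setT mul1e.
under [X in _ = X]eq_bigr do rewrite liftK.
move=> <-; last by move=> i; case: unliftP => [j _|_]; [exact: mA|exact: measurableT].
congr (P _); apply/seteqP; split => w /= h i _.
  by case: unliftP => [j ->|//]; exact: h.
by have := h (lift ord0 i) I; rewrite liftK.
Qed.

Lemma mx_of_tuples_cons n (x : d.-tuple R) (t : n.-tuple (d.-tuple R)) :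
  mx_of_tuples [tuple of x :: t] = col_mx (vec_of_tuple x) (mx_of_tuples t).
Proof.
apply/matrixP => i j; rewrite mxE; case: (unliftP ord0 i) => [k|] ->.
  rewrite tnthS (_ : lift ord0 k = rshift 1 k); last exact: val_inj.
  by rewrite [RHS]col_mxEd mxE.
rewrite tnth0 (_ : @ord0 n = @lshift 1 n ord0); last exact: val_inj.
by rewrite [RHS]col_mxEu mxE.
Qed.

(** By independence the joint law is the product of the law of the first vector and that of the
    others; a set all of whose sections are null is null by Fubini. *)
Lemma joint_law_cons n (u : 'I_n.+1 -> T -> d.-tuple R)
    (B : set (n.+1.-tuple (d.-tuple R))) :
  (forall i, measurable_fun setT (u i)) -> mutually_independent P u -> measurable B ->
  (forall x, P (joint (fun i => u (lift ord0 i)) @^-1`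
     [set t : n.-tuple (d.-tuple R) | B [tuple of x :: t]]) = 0%E) ->
  P (joint u @^-1` B) = 0%E.
Proof.
move=> mu indep mB B0; set v := fun i => u (lift ord0 i).
have mv : measurable_fun setT (joint v) by apply: measurable_joint => i; exact: mu.
pose X : {mfun T >-> d.-tuple R} :=
  HB.pack (u ord0) (isMeasurableFun.Build _ _ _ _ (u ord0) (mu ord0)).
pose V : {mfun T >-> n.-tuple (d.-tuple R)} :=
  HB.pack (joint v) (isMeasurableFun.Build _ _ _ _ (joint v) mv).
pose f2 (z : d.-tuple R * n.-tuple (d.-tuple R)) := [the n.+1.-tuple _ of z.1 :: z.2].
have mf2 : measurable_fun setT f2 by exact: measurable_cons.
have -> : P (joint u @^-1` B) = (distribution P X \x distribution P V)%E (f2 @^-1` B).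
  apply: (tuple_law_unique (P1 := P)) => //.
  - by rewrite [X in (X < _)%E]probability_setT ltry.
  - exact: measurable_joint.
  move=> A mA.
  have -> : f2 @^-1` box A = A ord0 `*` box (fun i => A (lift ord0 i)).
    apply/seteqP; split => [z h|z [h0 h] i].
      split; first by have := h ord0; rewrite tnth0.
      by move=> i; have := h (lift ord0 i); rewrite tnthS.
    by case: (unliftP ord0 i) => [j|] ->; rewrite ?tnth0 // tnthS; exact: h.
  transitivity (distribution P X (A ord0) *
      distribution P V (box (fun i => A (lift ord0 i))))%E; last first.
    by apply/esym/product_measure1E; [exact: mA|exact: measurable_box].
  rewrite preimage_joint_box [LHS](indep _ mA) big_ord_recl; congr (_ * _)%E.
  rewrite /distribution /pushforward /= preimage_joint_box.
  exact/esym/(mutually_independent_behead indep).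
have mB2 : measurable (f2 @^-1` B) by rewrite -[X in measurable X]setTI; exact: mf2.
rewrite /= /product_measure1 /= integral0_eq // => x _.
rewrite -[RHS](B0 x); congr (P _).
by apply/seteqP; split => w /=; rewrite /xsection /= inE.
Qed.

(** Induction on the number of vectors: with the first one fixed, either the others are already
    dependent, or by [det_gram_col_mx] the first lies in their span, which is [proj_full_null]. *)
Lemma singular_null n (u : 'I_n -> T -> d.-tuple R) : (n <= d)%N ->
  (forall i, uniform_on_sphere P (u i)) -> mutually_independent P u ->
  P (joint u @^-1` singular) = 0%E.
Proof.
elim: n u => [|n IH] u nd unif indep.
  rewrite (_ : _ @^-1` _ = set0) ?measure0 //; apply/seteqP; split => w //=.
  by rewrite /singular /= unitmxE det_mx00 unitr1.
have mu i : measurable_fun setT (u i) by have [] := unif i.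
set v := fun i => u (lift ord0 i).
have univ i : uniform_on_sphere P (v i) by exact: unif.
have indepv : mutually_independent P v by exact: mutually_independent_behead.
have mv := measurable_joint (fun i => mu (lift ord0 i)).
(* Restricting to a first vector of norm one makes [proj_full_null] applicable in every nonempty
   section; the complement is null by uniformity. *)
pose S : set (n.+1.-tuple (d.-tuple R)) := (fun t => tnth t ord0) @^-1` tsphere.
have mS : measurable S.
  rewrite -[X in measurable X]setTI.
  by apply: (measurable_tnth ord0) => //; exact: measurable_tsphere.
have mJ C : measurable C -> measurable (joint u @^-1` C).
  by move=> mC; rewrite -[X in measurable X]setTI; exact: (measurable_joint mu).
have h0 : P (joint u @^-1` (singular `&` S)) = 0%E.
  apply: joint_law_cons => //.
    by apply: measurableI => //; exact: measurable_singular.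
  move=> x; have [/eqP x1|x1] := boolP (dotv (vec_of_tuple x) (vec_of_tuple x) == 1); last first.
    rewrite [X in P X](_ : _ = set0) ?measure0 //; apply/seteqP; split => w //= -[_].
    by rewrite /S /preimage /tsphere /= tnth0 (negPf x1).
  have mv1 C : measurable C -> measurable (joint v @^-1` C).
    by move=> mC; rewrite -[X in measurable X]setTI; exact: mv.
  apply: (@subset_measure0 _ _ _ P _
    (joint v @^-1` singular `|` joint v @^-1` proj_event 1 (-1) (vec_of_tuple x))).
  - apply: mv1.
    have mc : measurable_fun setT (fun t : n.-tuple (d.-tuple R) => [the n.+1.-tuple _ of x :: t]).
      exact: measurable_cons.
    rewrite -[X in measurable X]setTI; apply: mc => //.
    by apply: measurableI => //; exact: measurable_singular.
  - by apply: measurableU; apply: mv1; [exact: measurable_singular|exact: measurable_proj_event].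
  - move=> w /= [h _]; have [gw|gw] := boolP (gram (mx_of_tuples (joint v w)) \in unitmx).
      right; rewrite /preimage /proj_event /= gw /=.
      move: h; rewrite /singular /= mx_of_tuples_cons unitmxE unitfE negbK.
      rewrite (det_gram_col_mx gw) mulf_eq0 => /orP[|/eqP q0].
        by move: gw; rewrite unitmxE unitfE => /negPf ->.
      by rewrite mul1r q0 mulr0.
    by left.
  - apply: etrans; last exact: IH (ltnW nd) univ indepv.
    apply: measureU0; last exact: proj_full_null.
      by apply: mv1; exact: measurable_singular.
    by apply: mv1; exact: measurable_proj_event.
apply: (@subset_measure0 _ _ _ P _
  (joint u @^-1` (singular `&` S) `|` (u ord0 @^-1` ~` tsphere))).
- by apply: mJ; exact: measurable_singular.
- apply: measurableU.
    by apply: mJ; apply: measurableI => //; exact: measurable_singular.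
  rewrite -[X in measurable X]setTI.
  by apply: mu => //; apply: measurableC; exact: measurable_tsphere.
- move=> w /= h; have [hs|hs] := pselect (tsphere (u ord0 w)); last by right.
  by left; split => //; rewrite /S /preimage /= tnth_mktuple.
- apply: etrans; last exact: h0.
  apply: measureU0; last exact: uniform_tsphere.
    by apply: mJ; apply: measurableI => //; exact: measurable_singular.
  rewrite -[X in measurable X]setTI.
  by apply: mu => //; apply: measurableC; exact: measurable_tsphere.
Qed.

End FullRank.

(** * Quadratic bounds for the exponential *)

Section ExponentialInequalities.
Context {R : realType}.
Implicit Types x t : R.

Lemma nonneg_of_deriv (h h' : R -> R) : h 0 = 0 ->
  (forall x, is_derive x 1 h (h' x)) -> (forall x, 0 <= x -> 0 <= h' x) ->
  forall x, 0 <= x -> 0 <= h x.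
Proof.
move=> h0 dh h'0 x x0; rewrite -h0.
apply: (@ger0_derive1_ndecr _ h 0 x) => //.
- by move=> y /itvP yx; rewrite derive1E (derive_val (is_derive := dh y)) h'0 // yx.
- apply: continuous_subspaceT => y; apply: differentiable_continuous.
  by apply/derivable1_diffP.
Qed.

Lemma expR_ge_quadratic x : 0 <= x -> 1 + x + x ^+ 2 / 2 <= expR x.
Proof.
move=> x0; rewrite -subr_ge0.
apply: (@nonneg_of_deriv (fun y => expR y - (1 + y + y ^+ 2 / 2))
  (fun y => expR y - (1 + y))) => //.
- by rewrite expR0 expr0n /= mul0r !addr0 subrr.
- by move=> y; apply: is_derive_eq; rewrite /GRing.scale /=; field.
- by move=> y _; rewrite subr_ge0 expR_ge1Dx.
Qed.

Lemma expR_le_quadratic x : 0 <= x -> (1 - x) * expR x <= 1 - x ^+ 2 / 2.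
Proof.
move=> x0; rewrite -subr_ge0.
apply: (@nonneg_of_deriv (fun y => 1 - y ^+ 2 / 2 - (1 - y) * expR y)
  (fun y => y * (expR y - 1))) => //.
- by rewrite expR0 expr0n /= mul0r !subr0 mulr1 subrr.
- by move=> y; apply: is_derive_eq; rewrite /GRing.scale /=; field.
- by move=> y y0; rewrite mulr_ge0 // subr_ge0 -expR0 ler_expR.
Qed.

End ExponentialInequalities.

(** * Beta tail bounds and concentration of the projected norm *)

Section TailBounds.
Context {R : realType} {d : nat} {dT : measure_display} {T : measurableType dT}.
Variable P : probability T R.

(* The exponent of [proj_chernoff] minimising its bound. *)
Definition chernoff_exponent (n : nat) (b : R) : R :=
  (n%:R - d%:R * b) / (d%:R * b * (1 - b)).

(** At the optimal exponent the two eigenvalues are [a = (d - n) / (d - s n)] and [a + y = 1 / s],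
    so the Chernoff bound is the square root of [s^n a ^ (- (d - n))]. Both tails are covered,
    according to whether [s] is below or above [1]. *)
Lemma proj_tail_rate n (u : 'I_n -> T -> d.-tuple R) (e : 'rV[R]_d) (s : R) :
  (0 < n < d)%N -> (forall i, uniform_on_sphere P (u i)) -> mutually_independent P u ->
  dotv e e = 1 -> 0 < s -> s * (n%:R / d%:R) < 1 ->
  (P (joint u @^-1` proj_event (s * (n%:R / d%:R))
        (chernoff_exponent n (s * (n%:R / d%:R))) e) <=
   (Num.sqrt ((s * expR (1 - s)) ^+ n))%:E)%E.
Proof.
move=> /andP[n0 nd] unif indep e1 s0; set b := s * _ => b1.
set y := chernoff_exponent n b.
have N0 : 0 < n%:R :> R by rewrite ltr0n.
have ND : n%:R < d%:R :> R by rewrite ltr_nat.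
have D0 : 0 < d%:R :> R by exact: lt_trans ND.
have b0 : 0 < b by rewrite mulr_gt0 // divr_gt0.
have b1' : 0 < 1 - b by rewrite subr_gt0.
have aE : 1 - y * b = (d%:R - n%:R) / (d%:R * (1 - b)).
  by rewrite /y /chernoff_exponent; field; rewrite !gt_eqF.
have ayE : 1 - y * b + y = s^-1.
  rewrite aE /y /chernoff_exponent /b; field.
  by rewrite !gt_eqF //=; move: b1'; rewrite /b mulrA subr_gt0 ltr_pdivrMr // mul1r -subr_gt0.
have a0 : 0 < 1 - y * b by rewrite aE divr_gt0 ?mulr_gt0 // subr_gt0.
have ay0 : 0 < 1 - y * b + y by rewrite ayE invr_gt0.
apply: le_trans (proj_chernoff unif indep e1 a0 ay0) _.
set a := 1 - y * b in aE ayE a0 ay0 *.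
have -> : a ^+ d * (1 + y / a) ^+ n = a ^+ (d - n) * s ^- n.
  rewrite -{1}(subnK (ltnW nd)) exprD -mulrA -exprMn -exprVn -ayE; congr (_ * _ ^+ _).
  by field; exact: lt0r_neq0.
rewrite lee_fin -sqrtrV; last by rewrite mulr_ge0 ?exprn_ge0 ?invr_ge0 ?exprn_ge0 // ltW.
rewrite ler_wsqrtr // invfM invrK exprMn mulrC ler_pM2l ?exprn_gt0 //.
have DN : 0 < d%:R - n%:R :> R by rewrite subr_gt0.
(* Here [1 / a = 1 + n (1 - s) / (d - n)], and [1 + x <= exp x] applies. *)
have aV : a^-1 <= expR (n%:R * (1 - s) / (d%:R - n%:R)).
  apply: le_trans (expR_ge1Dx _); rewrite aE /b le_eqVlt; apply/orP; left; apply/eqP.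
  have {}b1' : d%:R - s * n%:R != 0.
    by rewrite subr_eq0 eq_sym lt_eqF //; move: b1; rewrite /b mulrA ltr_pdivrMr // mul1r.
  by field; rewrite b1' !gt_eqF.
rewrite -exprVn; apply: le_trans (_ : expR (n%:R * (1 - s) / (d%:R - n%:R)) ^+ (d - n) <= _).
  by apply: lerXn2r; rewrite ?nnegrE ?invr_ge0 ?(ltW a0) ?expR_ge0.
rewrite -!expRM_natl natrB ?(ltnW nd) // ler_expR le_eqVlt; apply/orP; left; apply/eqP.
by field; exact: lt0r_neq0.
Qed.

Lemma sqrt_rate_le (m : nat) (delta s : R) : (0 < m)%N -> 0 < delta -> 0 <= s ->
  s * expR (1 - s) <= delta `^ (2 / m%:R) ->
  Num.sqrt ((s * expR (1 - s)) ^+ m) <= delta.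
Proof.
move=> m0 d0 s0 h.
have m0' : m%:R != 0 :> R by rewrite pnatr_eq0 -lt0n.
rewrite -[leRHS]ger0_norm ?(ltW d0) // -sqrtr_sqr ler_wsqrtr //.
apply: le_trans (_ : (delta `^ (2 / m%:R)) ^+ m <= _).
  by apply: lerXn2r; rewrite ?nnegrE ?mulr_ge0 ?expR_ge0 ?powR_ge0.
by rewrite -powR_mulrn ?powR_ge0 // -powRrM divfK // powR_mulrn // ltW.
Qed.

(** With [y = 2 sqrt (ln (1 / delta) / m)] the inverse is [s = 1 + y + y^2 / 2 <= exp y], so the
    rate [s exp (1 - s)] is at most [exp (- y^2 / 2)], which equals [delta ^ (2 / m)]. *)
Lemma zeta1V (m : nat) (delta : R) : (0 < m)%N -> 0 < delta < 1 ->
  1 <= (zeta1 m delta)^-1 /\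
  (zeta1 m delta)^-1 * expR (1 - (zeta1 m delta)^-1) <= delta `^ (2 / m%:R).
Proof.
move=> m0 /andP[d0 d1]; rewrite /zeta1 invrK.
have m0' : 0 < m%:R :> R by rewrite ltr0n.
set L := ln delta^-1.
have L0 : 0 <= L by rewrite ln_ge0 // ltW // invf_gt1.
have Lm : 0 <= L / m%:R by rewrite divr_ge0 // ltW.
set y := 2 * Num.sqrt (L / m%:R).
have y0 : 0 <= y by rewrite mulr_ge0 // sqrtr_ge0.
have yE : y ^+ 2 / 2 = 2 * L / m%:R.
  rewrite /y exprMn sqr_sqrtr //; field; exact: lt0r_neq0.
rewrite -yE; split.
  by rewrite -addrA lerDl addr_ge0 // divr_ge0 ?sqr_ge0.
apply: le_trans (_ : expR y * expR (1 - (1 + y + y ^+ 2 / 2)) <= _).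
  by rewrite ler_pM2r ?expR_gt0 // expR_ge_quadratic.
rewrite -expRD /powR gt_eqF // ler_expR yE /L lnV ?posrE //.
by rewrite le_eqVlt; apply/orP; left; apply/eqP; field; exact: lt0r_neq0.
Qed.

(** Write [a = delta ^ (2 / m) = 1 - t^2 / 2]. If the maximum is [1 - t], the rate is
    [(1 - t) exp t <= 1 - t^2 / 2]; if it is [s = a / e], the rate is [a exp (- s) <= a]. *)
Lemma zeta2V (m : nat) (delta : R) : (0 < m)%N -> 0 < delta < 1 ->
  0 < (zeta2 m delta)^-1 < 1 /\
  (zeta2 m delta)^-1 * expR (1 - (zeta2 m delta)^-1) <= delta `^ (2 / m%:R).
Proof.
move=> m0 /andP[d0 d1]; rewrite /zeta2 invrK.
have m0' : 0 < m%:R :> R by rewrite ltr0n.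
set a := delta `^ _.
have a0 : 0 < a by rewrite powR_gt0.
have a1 : a < 1.
  rewrite /a /powR gt_eqF // -[ltRHS]expR0 ltr_expR pmulr_rlt0 ?divr_gt0 //.
  by rewrite ln_lt0 // d0.
have e1 : expR (-1) < 1 :> R by rewrite -[ltRHS]expR0 ltr_expR ltrN10.
have ea0 : 0 < expR (-1) * a by rewrite mulr_gt0 ?expR_gt0.
have ea1 : expR (-1) * a < 1 by apply: mulr_ilt1 => //; exact: ltW.
set t := Num.sqrt _.
have t0 : 0 < t by rewrite sqrtr_gt0 mulr_gt0 // subr_gt0.
have tE : a = 1 - t ^+ 2 / 2.
  by rewrite sqr_sqrtr; [field|rewrite mulr_ge0 // subr_ge0 ltW].
split.
  by rewrite lt_max ea0 /= gt_max ea1 /=; lra.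
have [h|h] := leP (expR (-1) * a) (1 - t).
- by rewrite subKr tE expR_le_quadratic // ltW.
- rewrite mulrAC -expRD -[leRHS]mul1r ler_pM2r // -[leRHS]expR0 ler_expR.
  by move: ea0; lra.
Qed.

(** The event is the complement of the null singular set and of two tails, each of probability at
    most [delta]. *)
Lemma projection_concentration m (u : 'I_m -> T -> d.-tuple R) (e : 'rV[R]_d) (delta : R) :
  (0 < m < d)%N -> 0 < delta < 1 ->
  (forall i, uniform_on_sphere P (u i)) -> mutually_independent P u -> dotv e e = 1 ->
  exists E : set T, [/\ measurable E,
    forall w, E w -> let U := mx_of_tuples (joint u w) in
      [/\ gram U \in unitmx, (zeta2 m delta)^-1 * (m%:R / d%:R) <= qform (rowproj U) e &
          qform (rowproj U) e <= (zeta1 m delta)^-1 * (m%:R / d%:R)] &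
    ((1 - 2 * delta)%:E <= P E)%E].
Proof.
move=> md d01 unif indep e1; have /andP[m0 mltd] := md; have /andP[d0 d1] := d01.
set b2 := (zeta2 m delta)^-1 * _; set b1 := (zeta1 m delta)^-1 * _.
have [s1 r1] := zeta1V m0 d01; have [/andP[s20 s21] r2] := zeta2V m0 d01.
have D0 : 0 < d%:R :> R by rewrite ltr0n (leq_trans _ mltd).
have M0 : 0 < m%:R :> R by rewrite ltr0n.
have MD : m%:R / d%:R < 1 :> R by rewrite ltr_pdivrMr // mul1r ltr_nat.
have MD0 : 0 < m%:R / d%:R :> R by rewrite divr_gt0.
have DMD : d%:R * (m%:R / d%:R) = m%:R :> R by rewrite mulrC divfK // gt_eqF.
have b20 : 0 < b2 by rewrite mulr_gt0.
have b21 : b2 < 1 by rewrite /b2; nra.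
have mu i : measurable_fun setT (u i) by have [] := unif i.
have mJ C : measurable C -> measurable (joint u @^-1` C).
  by move=> mC; rewrite -[X in measurable X]setTI; exact: (measurable_joint mu).
pose B2 := joint u @^-1` proj_event b2 (chernoff_exponent m b2) e.
(* When [b1 >= 1] the upper bound holds trivially, since a projection does not increase the norm,
   and the Chernoff bound does not apply. *)
pose B1 := if b1 < 1 then joint u @^-1` proj_event b1 (chernoff_exponent m b1) e else set0.
pose B0 := joint u @^-1` @singular R d m.
have mB2 : measurable B2 by apply: mJ; exact: measurable_proj_event.
have mB1 : measurable B1.
  by rewrite /B1; case: ifP => // _; apply: mJ; exact: measurable_proj_event.
have mB0 : measurable B0 by apply: mJ; exact: measurable_singular.
have PB2 : (P B2 <= delta%:E)%E.
  apply: le_trans (proj_tail_rate md unif indep e1 s20 b21) _.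
  by rewrite lee_fin sqrt_rate_le // ltW.
have PB1 : (P B1 <= delta%:E)%E.
  rewrite /B1; case: ifP => b11; last by rewrite measure0 lee_fin ltW.
  have s10 := lt_le_trans ltr01 s1.
  apply: le_trans (proj_tail_rate md unif indep e1 s10 b11) _.
  by rewrite lee_fin sqrt_rate_le // ltW.
have PB0 : P B0 = 0%E by exact: singular_null (ltnW mltd) unif indep.
exists (~` (B0 `|` (B1 `|` B2))); split.
- by apply: measurableC; do ?apply: measurableU.
- move=> w /= h.
  have gw : gram (mx_of_tuples (joint u w)) \in unitmx.
    by apply/negPn/negP => gw; apply: h; left.
  split => //.
  + rewrite leNgt; apply/negP => q; apply: h; right; right.
    rewrite /B2 /preimage /proj_event /= gw e1 mulr1 /=.
    (* The exponent is nonnegative because [1 / zeta2 <= 1]; for the other tail it is nonpositive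
       because [1 / zeta1 >= 1]. *)
    apply: mulr_ge0; last by rewrite subr_ge0 ltW.
    apply: divr_ge0; last first.
      by apply: mulr_ge0; [apply: mulr_ge0; apply: ltW|rewrite subr_ge0 ltW].
    rewrite subr_ge0 (_ : _ * b2 = (zeta2 m delta)^-1 * m%:R); last by rewrite /b2 mulrCA DMD.
    by rewrite ler_piMl // ltW.
  + rewrite leNgt; apply/negP => q; apply: h; right; left.
    have b11 : b1 < 1 by apply: lt_le_trans q _; rewrite -e1 qform_rowproj_le.
    rewrite /B1 b11 /preimage /proj_event /= gw e1 mulr1 /=.
    have b10 : 0 < b1 by rewrite mulr_gt0 // (lt_le_trans ltr01).
    apply: mulr_le0; last by rewrite subr_le0 ltW.
    apply: mulr_le0_ge0; last first.
      by rewrite invr_ge0; apply: mulr_ge0; [apply: mulr_ge0; apply: ltW|rewrite subr_ge0 ltW].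
    rewrite subr_le0 (_ : _ * b1 = (zeta1 m delta)^-1 * m%:R); last by rewrite /b1 mulrCA DMD.
    by rewrite ler_peMl // ltW.
- rewrite probability_setC; last by do ?apply: measurableU.
  have PU : (P (B0 `|` (B1 `|` B2)) <= (2 * delta)%:E)%E.
    apply: le_trans (measureU2 _ mB0 (measurableU _ _ mB1 mB2)) _.
    rewrite [X in (X + _)%E]PB0 add0e; apply: le_trans (measureU2 _ mB1 mB2) _.
    rewrite mulr_natl mulr2n EFinD; exact: leeD.
  by rewrite EFinB; apply: leeB.
Qed.

End TailBounds.

(** * Geometry of the decision boundary *)

Section ClosestPoint.
Context {R : realType} {d L : nat}.
Variables (f : 'I_L -> 'rV[R]_d -> R) (x0 : 'rV[R]_d) (khat k : 'I_L) (rk : R).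
Hypothesis cf : forall i, continuous (f i).
Hypothesis label : f k x0 < f khat x0.
Hypothesis advE : adv_dist f x0 khat k setT = rk%:E.

Lemma lt_adv_dist (v : 'rV[R]_d) : enorm v < rk -> f k (x0 + v) < f khat (x0 + v).
Proof.
rewrite ltNge => vrk; rewrite ltNge; apply: contra vrk => h.
by rewrite -lee_fin -advE; apply: ereal_inf_lbound; exists v.
Qed.

Lemma coord_le_enorm (v : 'rV[R]_d) i : `|v 0 i| <= enorm v.
Proof.
rewrite -(ler_pXn2r (n := 2)) ?nnegrE ?enorm_ge0 // real_normK ?num_real // enorm_sqr dotvE.
rewrite (bigD1 i) //= expr2 lerDl; apply: sumr_ge0 => j _.
by rewrite -expr2 sqr_ge0.
Qed.

Lemma continuous_margin :
  continuous (fun v : 'rV[R]_d => f k (x0 + v) - f khat (x0 + v)).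
Proof.
move=> v; have ct : {for v, continuous (fun v => x0 + v)}.
  by apply: continuousD; [exact: cst_continuous|exact: cvg_id].
by apply: continuousB; apply: continuous_comp => //; exact: cf.
Qed.

Lemma continuous_dotv : continuous (fun v : 'rV[R]_d => dotv v v).
Proof.
rewrite (_ : (fun _ => _) = fun v : 'rV[R]_d => \sum_i v 0 i * v 0 i).
  apply: continuous_big => [|i _ v]; first exact: add_continuous.
  have ci : {for v, continuous (fun v : 'rV[R]_d => v 0 i)} by exact: coord_continuous.
  exact: (continuousM ci ci).
by apply/funext => w; rewrite dotvE.
Qed.

(** The set where [f k >= f khat] is closed, so the squared norm attains its minimum on the part
    inside a compact box of half-side [rk + 1], which contains all candidates of norm below
    [rk + 1]. *)
Lemma exists_closest : exists r : 'rV[R]_d,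
  [/\ enorm r = rk, 0 < rk & f k (x0 + r) = f khat (x0 + r)].
Proof.
pose C := [set v : 'rV[R]_d | 0 <= f k (x0 + v) - f khat (x0 + v)].
have clC : closed C.
  apply: (@closed_comp _ _ _ [set y : R | 0 <= y]); last exact: closed_ge.
  by move=> v _; exact: continuous_margin.
have rkC v : C v -> rk <= enorm v.
  by rewrite /C /= subr_ge0 leNgt => h; rewrite leNgt; apply: contra h; exact: lt_adv_dist.
have Clt eps : rk < eps -> exists2 v, C v & enorm v < eps.
  rewrite -lte_fin -advE => /ereal_inf_lt[_ [v [_ h] <-]].
  by rewrite lte_fin => veps; exists v; rewrite // /C /= subr_ge0.
pose box1 := [set v : 'rV[R]_d | forall i, [set` `[- (rk + 1), rk + 1]] (v ord0 i)].
have cbox : compact box1.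
  apply: (@rV_compact R d (fun=> [set` `[- (rk + 1), rk + 1]])) => i.
  exact: segment_compact.
have cpt : compact (C `&` box1).
  apply: (@subclosed_compact _ _ box1) => //.
  by apply: closedI => //; apply: compact_closed => //; exact: norm_hausdorff.
have box1_enorm v : enorm v < rk + 1 -> box1 v.
  move=> vrk i; rewrite /= in_itv /= -ler_norml.
  exact: le_trans (coord_le_enorm v i) (ltW vrk).
have ne : (C `&` box1) !=set0.
  have [v Cv /box1_enorm bv] : exists2 v, C v & enorm v < rk + 1 by apply: Clt; rewrite ltrDl.
  by exists v.
have cd : {within C `&` box1, continuous (fun v : 'rV[R]_d => dotv v v)}.
  by apply: continuous_subspaceT; exact: continuous_dotv.
have [c cC cmin] := compact_EVT_min ne cpt cd.
have [Cc _] : (C `&` box1) c by rewrite inE in cC.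
have crk : enorm c = rk.
  apply/eqP; rewrite eq_le rkC // andbT leNgt; apply/negP => rkc.
  have [|v Cv] := Clt (Num.min (enorm c) (rk + 1)); first by rewrite lt_min rkc ltrDl ltr01.
  rewrite lt_min => /andP[vc /box1_enorm bv].
  have := cmin v (mem_set (conj Cv bv)); rewrite -!enorm_sqr.
  by rewrite ler_pXn2r ?nnegrE ?enorm_ge0 // leNgt vc.
have rk0 : 0 < rk.
  rewrite -crk lt_def enorm_ge0 andbT; apply/eqP => c0.
  have : c == 0 by rewrite -dotv_eq0 -enorm_sqr c0 expr0n.
  by move=> /eqP cE; move: Cc; rewrite /C /= cE addr0 subr_ge0 leNgt label.
exists c; split => //; apply/eqP; rewrite eq_le.
move: Cc; rewrite /C /= subr_ge0 => ->; rewrite andbT leNgt; apply/negP => lt_c.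
(* If the inequality were strict at [c], it would persist at a slightly shorter multiple of [c],
   against the minimality of [rk]. *)
pose phi (t : R) : R := f k (x0 + t *: c) - f khat (x0 + t *: c).
have cphi : continuous phi.
  move=> t; apply: (@continuous_comp _ _ _ (fun t : R => t *: c)
     (fun v => f k (x0 + v) - f khat (x0 + v))); last exact: continuous_margin.
  by apply: continuousZl; exact: cvg_id.
have phi1 : 0 < phi 1 by rewrite /phi scale1r subr_gt0.
have /nbhs_ballP[eps /= eps0 heps] := cphi 1 _ (lt_nbhsr phi1).
pose t : R := 1 - Num.min (eps / 2) 1.
have m0 : 0 < Num.min (eps / 2) 1 by rewrite lt_min divr_gt0 //=.
have tball : ball (1 : R) eps t.
  rewrite /ball /= /t opprB addrC subrK gtr0_norm //.
  by rewrite gt_min; apply/orP; left; rewrite ltr_pdivrMr // mulr_natr mulr2n ltrDl.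
have := heps t tball; rewrite /= /phi subr_gt0; apply/negP; rewrite -leNgt ltW //.
apply: lt_adv_dist; rewrite enormZ crk gtr_pMl // ger0_norm /t.
  by rewrite gtrDl oppr_lt0.
by rewrite subr_ge0 ge_min lexx orbT.
Qed.

End ClosestPoint.

(** * Tangent balls and their intersection with a subspace *)

Section TangentBalls.
Context {R : realType} {d : nat}.
Implicit Types (a p z v e : 'rV[R]_d).

(** Disjointness forces the centres at least [r1 + r2] apart, while the path through [p] has exactly
    this length: the equality case of the triangle inequality, obtained from
    [|r1 (z - p) + r2 (a - p)|^2 <= 0]. *)
Lemma tangent_balls a z p (r1 r2 : R) : 0 < r1 -> 0 < r2 ->
  enorm (a - p) = r1 -> enorm (z - p) = r2 ->
  (forall x, eball a r1 x -> eball z r2 x -> False) ->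
  z - p = - (r2 / r1) *: (a - p).
Proof.
move=> r10 r20 ap zp disj.
have r120 : 0 < r1 + r2 by rewrite addr_gt0.
have sep : (r1 + r2) ^+ 2 <= dotv (a - z) (a - z).
  rewrite leNgt; apply/negP; rewrite -enorm_sqr ltr_pXn2r ?nnegrE ?enorm_ge0 ?ltW // => az.
  have key (r : R) : 0 < r -> r / (r1 + r2) * enorm (a - z) < r.
    by move=> r0; rewrite mulrAC ltr_pdivrMr // ltr_pM2l.
  (* The point dividing the segment of centres in the ratio [r1 : r2] would lie in both balls. *)
  apply: (disj (a + (r1 / (r1 + r2)) *: (z - a))); rewrite /eball /=.
    rewrite addrC addKr enormZ -opprB -scaleN1r enormZ normrN1 mul1r ger0_norm ?key //.
    by rewrite divr_ge0 // ltW.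
  rewrite (_ : _ - z = (r2 / (r1 + r2)) *: (a - z)).
    by rewrite enormZ ger0_norm ?key // divr_ge0 // ltW.
  by apply/rowP => i; rewrite !mxE; field; exact: lt0r_neq0.
set A := a - p in ap *; set Z := z - p in zp *.
have azE : a - z = A - Z by rewrite /A /Z opprB addrA subrK.
clearbody A Z.
have AA : dotv A A = r1 ^+ 2 by rewrite -enorm_sqr ap.
have ZZ : dotv Z Z = r2 ^+ 2 by rewrite -enorm_sqr zp.
have AZ : dotv A Z <= - (r1 * r2).
  move: sep; rewrite azE !(dotvDl, dotvDr, dotvNl, dotvNr) AA ZZ (dotvC Z A).
  by move=> sep; lra.
have : dotv (r1 *: Z + r2 *: A) (r1 *: Z + r2 *: A) <= 0.
  rewrite !(dotvDl, dotvDr, dotvZl, dotvZr) AA ZZ (dotvC Z A).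
  rewrite (_ : _ + _ = 2 * (r1 * r2) * (dotv A Z + r1 * r2)); last by ring.
  by rewrite pmulr_rle0 ?mulr_gt0 //; lra.
rewrite le_eqVlt ltNge dotv_ge0 orbF dotv_eq0 addr_eq0 => /eqP h.
apply: (scalerI (lt0r_neq0 r10)); rewrite h scalerA mulrN mulrC divfK ?lt0r_neq0 //.
by rewrite scaleNr.
Qed.

Variables (m : nat) (U : 'M[R]_(m, d)) (e : 'rV[R]_d) (r b : R).
Hypotheses (uU : gram U \in unitmx) (e1 : dotv e e = 1) (r0 : 0 < r) (b0 : 0 < b).
Local Notation c2 := (qform (rowproj U) e).

(** The witness is a multiple of the projection of [e], of length [r w / sqrt c2] with
    [w = 1 + 9/4 h] and [h = r / (rho c2)]. As [h <= 1/4] gives [w < 2], the term [h w^2 <= 4 h] is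
    beaten by [2 w - 2 = 9/2 h], which puts the witness inside the ball. *)
Lemma row_reaches_ball (kap rho : R) : b <= c2 -> 0 < kap -> kap^-1 < rho ->
  r * kap <= b / 4 ->
  exists c : 'rV[R]_m, eball ((r + rho) *: e) rho (c *m U) /\
    enorm (c *m U) <= r * (1 + 9 / 4 * (r * kap / b)) / Num.sqrt b.
Proof.
move=> bc kap0 kaprho rkap.
have rho0 : 0 < rho by apply: lt_trans kaprho; rewrite invr_gt0.
have c0 : 0 < c2 by exact: lt_le_trans bc.
have krho : rho^-1 < kap by rewrite invf_plt ?posrE.
set h := r / rho / c2.
have h0 : 0 < h by rewrite !divr_gt0.
have hle : h <= r * kap / b.
  rewrite /h; apply: ler_pM; first by apply: divr_ge0; exact: ltW.
  - by rewrite invr_ge0 ltW.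
  - by rewrite ler_pM2l // ltW.
  - by rewrite lef_pV2 ?posrE.
have h4 : h <= 1 / 4.
  by apply: le_trans hle _; rewrite ler_pdivrMr //; lra.
set w := 1 + 9 / 4 * h; set s := r * w / c2.
exists (s *: (e *m (U^T *m invmx (gram U)))).
have -> : s *: (e *m (U^T *m invmx (gram U))) *m U = s *: (e *m rowproj U).
  by rewrite -scalemxAl -mulmxA.
have vv : dotv (e *m rowproj U) (e *m rowproj U) = c2 by rewrite -qform_rowproj.
have ve : dotv (e *m rowproj U) e = c2 by rewrite -qformE.
have w0 : 0 < w by rewrite /w; lra.
have w2 : w < 2 by rewrite /w; lra.
have s0 : 0 < s by rewrite divr_gt0 // mulr_gt0.
split.
  rewrite /eball /= -(ltr_pXn2r (n := 2)) ?nnegrE ?enorm_ge0 ?ltW // enorm_sqr.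
  rewrite !(dotvDl, dotvDr, dotvNl, dotvNr, dotvZl, dotvZr) vv ve (dotvC e) ve e1 -subr_lt0.
  rewrite (_ : _ - _ = r * rho * (h * w ^+ 2 - 2 * w + 2 + (r / rho) * (1 - 2 * w))); last first.
    by rewrite /s /h; field; rewrite !gt_eqF.
  rewrite pmulr_rlt0 ?mulr_gt0 //.
  have : r / rho * (1 - 2 * w) < 0 by rewrite pmulr_rlt0 ?divr_gt0 // /w; lra.
  have : h * w ^+ 2 <= h * 4 by rewrite ler_pM2l // expr2; nra.
  by rewrite {4}/w; lra.
rewrite enormZ enormE vv ger0_norm ?(ltW s0) //.
have -> : s * Num.sqrt c2 = r * w / Num.sqrt c2.
  rewrite /s -{1}[c2]sqr_sqrtr ?(ltW c0) //; field.
  by rewrite sqrtr_eq0 -ltNge.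
rewrite ler_pM ?invr_ge0 ?sqrtr_ge0 ?mulr_ge0 ?(ltW r0) ?(ltW w0) //.
  by rewrite ler_pM2l // /w; lra.
by rewrite lef_pV2 ?posrE ?sqrtr_gt0 // ler_wsqrtr.
Qed.

(** For [v] in the row space, [v.e <= |v| sqrt B]. Lying outside the ball means
    [|v|^2 + 2 (rho - r) v.e >= 2 r rho - r^2], which fails when [|v|] is below the claimed
    bound. *)
Lemma row_avoids_ball (kap rho B : R) (c : 'rV[R]_m) : c2 <= B -> b <= B -> b <= 1 ->
  0 < kap -> kap^-1 < rho -> r * kap <= b / 4 ->
  ~ eball ((r - rho) *: e) rho (c *m U) ->
  r * (1 - 5 / 8 * (r * kap / b)) / Num.sqrt B <= enorm (c *m U).
Proof.
(* The closing contradiction, used with [x = r], [X = r / b], [y1 = kk rho] and [y2 = kk r]. *)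
have contra_aux (x X y1 y2 : R) : 0 < x -> 0 < X ->
    x - X + 5 / 4 * y1 - 5 / 4 * y2 < 0 -> X < y1 -> y2 <= x / 4 -> False by lra.
move=> cB bB b1 kap0 kaprho rkap; set v := c *m U.
have rho0 : 0 < rho by apply: lt_trans kaprho; rewrite invr_gt0.
have B0 : 0 < B by exact: lt_le_trans bB.
have sB0 : 0 < Num.sqrt B by rewrite sqrtr_gt0.
have kr1 : 1 < kap * rho by rewrite mulrC -ltr_pdivrMr // mul1r.
rewrite /eball /= => /negP; rewrite -leNgt.
rewrite -(ler_pXn2r (n := 2)) ?nnegrE ?enorm_ge0 ?(ltW rho0) // enorm_sqr.
rewrite !(dotvDl, dotvDr, dotvNl, dotvNr, dotvZl, dotvZr) (dotvC e) e1 -enorm_sqr.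
have ve : dotv v e <= enorm v * Num.sqrt B.
  have -> : dotv v e = dotv v (e *m rowproj U).
    by rewrite -[v in LHS](_ : v *m rowproj U = v) ?dotv_mulmx ?rowprojT // -mulmxA mulmx_rowproj.
  apply: le_trans (dotv_le_enorm _ _) _; apply: ler_wpM2l; first exact: enorm_ge0.
  by rewrite enormE -qform_rowproj // ler_wsqrtr.
have tau0 := enorm_ge0 v.
set tau := enorm v in ve tau0 *; set q := dotv v e in ve *.
set kk := r * kap / b; set w := 1 - 5 / 8 * kk => out.
have kk0 : 0 < kk by rewrite divr_gt0 // mulr_gt0.
have kk4 : kk <= 1 / 4 by rewrite ler_pdivrMr //; lra.
rewrite leNgt; apply/negP; rewrite ltr_pdivlMr // => tB.
(* Since [kap rho > 1] while [kap r <= b / 4 <= 1 / 4]. *)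
have rrho : r < rho.
  rewrite ltNge; apply/negP => h.
  have : kap * rho <= kap * r by rewrite ler_pM2l.
  by lra.
have w0 : 0 < w by rewrite /w; lra.
have w1 : w ^+ 2 / B <= b^-1.
  rewrite -[leRHS]mul1r; apply: ler_pM; rewrite ?sqr_ge0 ?invr_ge0 ?(ltW B0) //.
    by rewrite expr_le1 ?(ltW w0) //; rewrite /w; lra.
  by rewrite lef_pV2 ?posrE.
have t2 : tau ^+ 2 <= r * (r / b).
  apply: le_trans (_ : (r * w) ^+ 2 / B <= _).
    rewrite ler_pdivlMr // -[B in leLHS]sqr_sqrtr ?(ltW B0) // -exprMn.
    by apply: lerXn2r; rewrite ?nnegrE ?(ltW tB) ?mulr_ge0 ?sqrtr_ge0 ?(ltW r0) ?(ltW w0).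
  by rewrite exprMn expr2 -!mulrA !ler_pM2l // mulrA -expr2.
have qw : q * (rho - r) < r * w * (rho - r).
  by rewrite ltr_pM2r ?subr_gt0 //; exact: le_lt_trans tB.
have krho : r / b < kk * rho.
  rewrite (_ : kk * rho = kap * rho * (r / b)); last by rewrite /kk; field; exact: lt0r_neq0.
  by rewrite ltr_pMl // divr_gt0.
have kr : kk * r <= r / 4 by rewrite (_ : r / 4 = 1 / 4 * r) ?ler_pM2r //; lra.
set X := r / b in t2 krho.
have X0 : 0 < X by rewrite divr_gt0.
have : r * (2 * rho - r - X - 2 * w * (rho - r)) < 0 by lra.
rewrite pmulr_rlt0 // /w.
rewrite (_ : _ - _ = r - X + 5 / 4 * (kk * rho) - 5 / 4 * (kk * r)); last by field.
by move=> h; exact: contra_aux r0 X0 h krho kr.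
Qed.

End TangentBalls.

(** * Curvature and touching balls *)

Section Curvature.
Context {R : realType} {d L : nat}.
Variable f : 'I_L -> 'rV[R]_d -> R.

(** The degenerate choice [z = p] gives an empty ball. *)
Lemma q_dir_ge0 i j p : (0 <= q_dir f i j p)%E.
Proof.
apply: ereal_sup_ubound; exists p; last by rewrite subrr -(scale0r 0) enormZ normr0 mul0r.
by move=> x; rewrite /eball /= subrr -[in X in _ < X](scale0r 0) enormZ normr0 mul0r ltNge enorm_ge0.
Qed.

Lemma q_boundary_ge0 i j : (0 <= q_boundary f i j)%E.
Proof.
by apply: le_ereal_inf_tmp => _ [p _ <-]; rewrite /q_pair le_min !q_dir_ge0.
Qed.

(** The finite bound rules out [q = 0], whose curvature is infinite. The strict [kap] reflects that
    the supremum defining the touching radius need not be attained. *)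
Lemma curvature_fine (i j : 'I_L) (M : R) : (curvature f i j <= M%:E)%E ->
  [/\ 0 <= fine (curvature f i j), fine (curvature f i j) <= M &
   forall kap, fine (curvature f i j) < kap -> ((kap^-1)%:E < q_boundary f i j)%E].
Proof.
rewrite /curvature; have := q_boundary_ge0 i j.
case: (q_boundary f i j) => [q| |] //; rewrite /inve.
- rewrite lee_fin; case: eqVneq => [-> //|q0 q0' /=]; rewrite lee_fin => qM.
  have {q0 q0'} q0 : 0 < q by rewrite lt_def q0.
  split=> //; first by rewrite invr_ge0 ltW.
  by move=> kap qk; rewrite lte_fin invf_plt ?posrE // (lt_trans _ qk) // invr_gt0.
- by move=> _; rewrite lee_fin => M0; split=> // kap _; rewrite ltry.
Qed.

Lemma exists_touching_ball (i j : 'I_L) (p : 'rV[R]_d) (s : R) :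
  (s%:E < q_dir f i j p)%E ->
  exists2 z, s < enorm (z - p) & eball z (enorm (z - p)) `<=` region f i j.
Proof. by move=> /ereal_sup_gt[_ [z hz <-]]; rewrite lte_fin => sz; exists z. Qed.

Lemma lt_q_boundary (i j : 'I_L) (p : 'rV[R]_d) (s : R) :
  boundary f i j p -> (s%:E < q_boundary f i j)%E ->
  (s%:E < q_dir f i j p)%E /\ (s%:E < q_dir f j i p)%E.
Proof.
move=> bp sq; have : (s%:E < q_pair f i j p)%E.
  by apply: lt_le_trans sq _; apply: ereal_inf_lbound; exists p.
by rewrite /q_pair lt_min => /andP.
Qed.

End Curvature.

(** Touching balls of radius above [1 / kap] are available only for [kap] above the curvature; this
    passes to the limit in bounds affine in [kap]. *)
Lemma affine_le_right_limit {R : realType} (a A C k0 k1 : R) : 0 <= C -> k0 < k1 ->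
  (forall k, k0 < k <= k1 -> a <= A + C * k) -> a <= A + C * k0.
Proof.
move=> C0 k01 h; rewrite leNgt; apply/negP => lt_a.
set g := a - (A + C * k0); have g0 : 0 < g by rewrite subr_gt0.
have C1 : 0 < C + 1 by rewrite ltr_wpDl.
have k0' : k0 < k0 + g / (C + 1) / 2 by rewrite ltrDl !divr_gt0.
have := h (Num.min k1 (k0 + g / (C + 1) / 2)).
rewrite lt_min k01 k0' ge_min lexx => /(_ isT); apply/negP; rewrite -ltNge.
apply: le_lt_trans (_ : A + C * (k0 + g / (C + 1) / 2) < _).
  by rewrite lerD2l ler_wpM2l // ge_min lexx orbT.
rewrite mulrDr addrA -ltrBrDl -/g !mulrA ltr_pdivrMr // ltr_pdivrMr //.
rewrite -mulrA (mulrC C) ltr_pM2l //; lra.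
Qed.

(** * Adversarial distance along a fixed subspace *)

Section SubspaceBounds.
Context {R : realType} {d m L : nat}.
Variables (f : 'I_L -> 'rV[R]_d -> R) (x0 r : 'rV[R]_d) (khat k : 'I_L) (rk : R).
Hypotheses (rkE : enorm r = rk) (rk0 : 0 < rk).
Hypothesis pE : f k (x0 + r) = f khat (x0 + r).
Hypothesis inner : forall v, enorm v < rk -> f k (x0 + v) < f khat (x0 + v).
Let e := rk^-1 *: r.

Lemma unit_dir : dotv e e = 1.
Proof. by rewrite dotvZl dotvZr -enorm_sqr rkE; field; exact: lt0r_neq0. Qed.

Lemma touching_balls (kap : R) : 0 < kap -> ((kap^-1)%:E < q_boundary f k khat)%E ->
  exists rho1 rho2, [/\ kap^-1 < rho1, kap^-1 < rho2,
    eball (x0 + (rk + rho1) *: e) rho1 `<=` region f k khat &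
    eball (x0 + (rk - rho2) *: e) rho2 `<=` region f khat k].
Proof.
move=> kap0 kq; set p := x0 + r.
have bp : boundary f k khat p by rewrite /boundary /= pE subrr.
have [/exists_touching_ball[z1 kz1 b1] /exists_touching_ball[z2 kz2 b2]] := lt_q_boundary bp kq.
have kV0 : 0 < kap^-1 by rewrite invr_gt0.
have rE : r = rk *: e by rewrite scalerA mulfV ?scale1r // lt0r_neq0.
have xp : x0 - p = - rk *: e by rewrite /p opprD addrA subrr add0r scaleNr -rE.
have z1E : z1 - p = enorm (z1 - p) *: e.
  rewrite {1}(@tangent_balls _ _ x0 z1 p rk (enorm (z1 - p))) //.
  - by rewrite xp scalerA mulrNN divfK // lt0r_neq0.
  - exact: lt_trans kz1.
  - by rewrite xp scaleNr -scaleN1r enormZ normrN1 mul1r -rE.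
  - move=> x; rewrite /eball /= => hx /b1; rewrite /region /=.
    by have := inner hx; rewrite addrC subrK => /lt_trans /[apply]; rewrite ltxx.
(* The reference is now the ball around [z1]: the ball around [x0] lies in the same region as the
   one around [z2] and need not be disjoint from it. *)
have z2E : z2 - p = - enorm (z2 - p) *: e.
  rewrite {1}(@tangent_balls _ _ z1 z2 p (enorm (z1 - p)) (enorm (z2 - p))) //.
  - rewrite {2}z1E scalerA mulNr divfK // lt0r_neq0 //; exact: lt_trans kz1.
  - exact: lt_trans kz1.
  - exact: lt_trans kz2.
  - by move=> x /b1 + /b2; rewrite /region /= => /lt_trans /[apply]; rewrite ltxx.
exists (enorm (z1 - p)), (enorm (z2 - p)); split => //.
- by rewrite scalerDl -rE addrA -/p -z1E addrC subrK.
- by rewrite scalerDl -rE addrA -/p -z2E addrC subrK.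
Qed.

Variables (U : 'M[R]_(m, d)) (S : set 'rV[R]_d) (b B kap0 : R).
Hypothesis SE : forall v, S v <-> exists c : 'rV[R]_m, v = c *m U.
Hypotheses (uU : gram U \in unitmx) (b0 : 0 < b) (b1 : b <= 1) (bB : b <= B).
Hypotheses (bc : b <= qform (rowproj U) e) (cB : qform (rowproj U) e <= B).
Hypotheses (kap00 : 0 <= kap0) (kapb : rk * kap0 <= b / 5).
Hypothesis kapq : forall kap, kap0 < kap -> ((kap^-1)%:E < q_boundary f k khat)%E.

Lemma adv_dist_span_bounds : exists a, [/\ adv_dist f x0 khat k S = a%:E,
  rk * (1 - 5 / 8 * (rk * kap0 / b)) / Num.sqrt B <= a &
  a <= rk * (1 + 9 / 4 * (rk * kap0 / b)) / Num.sqrt b].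
Proof.
have e1 := unit_dir.
have B0 : 0 < B by exact: lt_le_trans bB.
(* The gap between the assumed [b / 5] and the [b / 4] required by the ball lemmas leaves an
   interval of admissible [kap] above [kap0]. *)
pose k1 := b / 4 / rk.
have k01 : kap0 < k1 by rewrite ltr_pdivlMr // mulrC; apply: le_lt_trans kapb _; have := b0; lra.
have bounds kap : kap0 < kap <= k1 ->
    ((rk * (1 - 5 / 8 * (rk * kap / b)) / Num.sqrt B)%:E <= adv_dist f x0 khat k S)%E /\
    (adv_dist f x0 khat k S <= (rk * (1 + 9 / 4 * (rk * kap / b)) / Num.sqrt b)%:E)%E.
  move=> /andP[kk kk1]; have kap_gt0 : 0 < kap by exact: le_lt_trans kk.
  have rkk : rk * kap <= b / 4 by rewrite mulrC -ler_pdivlMr.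
  have [rho1 [rho2 [h1 h2 ball1 ball2]]] := touching_balls kap_gt0 (kapq kk).
  split.
  - apply: le_ereal_inf_tmp => _ [v [/SE[c ->] adv] <-]; rewrite lee_fin.
    apply: (row_avoids_ball uU e1 rk0 b0 cB bB b1 kap_gt0 h2 rkk) => out.
    have /ball2 : eball (x0 + (rk - rho2) *: e) rho2 (x0 + c *m U).
      by move: out; rewrite /eball /= [in X in _ -> X]opprD addrACA subrr add0r.
    by rewrite /region /= ltNge adv.
  - have [c [inb cle]] := row_reaches_ball uU e1 rk0 b0 bc kap_gt0 h1 rkk.
    apply: le_trans (_ : (enorm (c *m U))%:E <= _)%E; last by rewrite lee_fin.
    apply: ereal_inf_lbound; exists (c *m U) => //; split; first by apply/SE; exists c.
    apply: ltW; apply: ball1; by move: inb; rewrite /eball /= [in X in _ -> X]opprD addrACA subrr add0r.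
(* A single admissible [kap] already confines the distance between two reals, hence it is finite. *)
have [l u] : _ /\ _ := bounds k1 ltac:(by rewrite k01 lexx).
have advfin : adv_dist f x0 khat k S \is a fin_num.
  by apply/fin_numP; split; apply/eqP => h; move: l u; rewrite h.
exists (fine (adv_dist f x0 khat k S)); rewrite fineK //.
set a := fine _; have aE : adv_dist f x0 khat k S = a%:E by rewrite fineK.
have sB0 : Num.sqrt B != 0 by rewrite gt_eqF // sqrtr_gt0.
have sb0 : Num.sqrt b != 0 by rewrite gt_eqF // sqrtr_gt0.
have bn0 : b != 0 by rewrite gt_eqF.
split => //.
- rewrite -lerN2.
  rewrite (_ : - (rk * _ / _) = - (rk / Num.sqrt B) + 5 / 8 * rk ^+ 2 / b / Num.sqrt B * kap0);
    last by field; rewrite bn0 sB0.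
  apply: (affine_le_right_limit _ k01) => [|kap /bounds[lk _]].
    by rewrite !mulr_ge0 ?invr_ge0 ?sqrtr_ge0 ?(ltW b0) // ltW.
  move: lk; rewrite aE lee_fin -lerN2 => /le_trans; apply.
  by rewrite le_eqVlt; apply/orP; left; apply/eqP; field; rewrite bn0 sB0.
- rewrite [leRHS](_ : _ = rk / Num.sqrt b + 9 / 4 * rk ^+ 2 / b / Num.sqrt b * kap0);
    last by field; rewrite bn0 sb0.
  apply: (affine_le_right_limit _ k01) => [|kap /bounds[_ uk]].
    by rewrite !mulr_ge0 ?invr_ge0 ?sqrtr_ge0 ?(ltW b0) // ltW.
  move: uk; rewrite aE lee_fin => /le_trans; apply.
  by rewrite le_eqVlt; apply/orP; left; apply/eqP; field; rewrite bn0 sb0.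
Qed.

End SubspaceBounds.

Lemma span_of_mx {R : realType} {d m : nat} {dT : measure_display} {T : measurableType dT}
    (u : 'I_m -> T -> d.-tuple R) (w : T) (v : 'rV[R]_d) :
  span_of u w v <-> exists c : 'rV[R]_m, v = c *m mx_of_tuples (joint u w).
Proof.
have rowE i : row i (mx_of_tuples (joint u w)) = vec_of_tuple (u i w).
  by apply/rowP => j; rewrite !mxE tnth_mktuple.
split=> -[c ->].
  exists (\row_i c i); rewrite mulmx_sum_row; apply: eq_bigr => i _.
  by rewrite rowE mxE.
by exists (fun i => c 0 i); rewrite mulmx_sum_row; apply: eq_bigr => i _; rewrite rowE.
Qed.

(** The probability is carried by a measurable [E] inside the set where the bounds hold, so that
    measurability of that set need not be established. The real [rk] encodes the finite unrestricted
    distance, and the curvature hypothesis makes [fine] the true value. *)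
Theorem theorem2 (R : realType) (d m L : nat) (delta : R)
  (f : 'I_L -> 'rV[R]_d -> R) (x0 : 'rV[R]_d) (khat k : 'I_L) (rk : R)
  (dT : measure_display) (T : measurableType dT) (P : probability T R)
  (u : 'I_m -> T -> d.-tuple R) :
  (2 <= d)%N -> (1 <= m)%N -> (m < d)%N -> 0 < delta < 1 ->
  (forall i, continuous (f i)) ->
  (forall i j, i != j -> smooth_hypersurface (boundary f i j)) ->
  (forall j, j != khat -> f khat x0 > f j x0) ->
  k != khat ->
  adv_dist f x0 khat k setT = rk%:E ->
  (curvature f k khat <=
     ((1 / 5) / (zeta2 m delta * rk) * (m%:R / d%:R))%:E)%E ->
  (forall i, uniform_on_sphere P (u i)) ->
  mutually_independent P u ->
  let z1 := zeta1 m delta in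
  let z2 := zeta2 m delta in
  let kap := fine (curvature f k khat) in
  let lower := (1 - (5 / 8) * rk * kap * z2 * (d%:R / m%:R))
                 * Num.sqrt z1 * Num.sqrt (d%:R / m%:R) in
  let upper := (1 + (9 / 4) * rk * kap * z2 * (d%:R / m%:R))
                 * Num.sqrt z2 * Num.sqrt (d%:R / m%:R) in
  exists E : set T, [/\ measurable E,
    E `<=` [set w | (lower%:E <= adv_dist f x0 khat k (span_of u w) * (rk^-1)%:E
                     <= upper%:E)%E] &
    ((1 - 4 * delta)%:E <= P E)%E].
Proof.
move=> d2 m1 md d01 cf _ label kk advE curv unif indep z1 z2 kap lower upper.
have [r [rkE rk0 pE]] := exists_closest cf (label k kk) advE.
set e := rk^-1 *: r; have e1 : dotv e e = 1 by exact: unit_dir.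
have m0md : (0 < m < d)%N by rewrite m1.
have [E [mE hE PE]] := projection_concentration m0md d01 unif indep e1.
exists E; split => //; last first.
  (* The event found has probability at least [1 - 2 delta], more than is claimed. *)
  apply: le_trans PE; rewrite lee_fin lerB // ler_pM2r; first by rewrite ler_nat.
  by case/andP: d01.
move=> w /hE /=; set U := mx_of_tuples _ => -[uU bc cB].
have [s1 _] := zeta1V m1 d01; have [/andP[s20 s21] _] := zeta2V m1 d01.
have M0 : 0 < m%:R :> R by rewrite ltr0n.
have D0 : 0 < d%:R :> R by rewrite ltr0n (leq_trans _ d2).
have MD0 : 0 < m%:R / d%:R :> R by rewrite divr_gt0.
have MD1 : m%:R / d%:R <= 1 :> R by rewrite ler_pdivrMr // mul1r ler_nat ltnW.
have z10 : 0 < z1 by rewrite -invr_gt0; exact: lt_le_trans s1.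
have z20 : 0 < z2 by rewrite -invr_gt0.
have [kap0 kapM kapq] := curvature_fine curv.
set b := (zeta2 m delta)^-1 * _ in bc; set B := (zeta1 m delta)^-1 * _ in cB.
have b0 : 0 < b by rewrite mulr_gt0.
have b1 : b <= 1 by rewrite mulr_ile1 ?(ltW s20) ?(ltW s21) ?(ltW MD0).
have bB : b <= B by rewrite ler_pM2r // (le_trans (ltW s21)).
(* With [b = m / (zeta2 d)], the constant [1/5] of the hypothesis gives exactly [b / 5]. *)
have kapb : rk * kap <= b / 5.
  apply: le_trans (ler_wpM2l (ltW rk0) kapM) _; rewrite /b -/z2 le_eqVlt.
  by apply/orP; left; apply/eqP; field; rewrite !gt_eqF.
have [a [-> la ua]] := adv_dist_span_bounds rkE rk0 pE (lt_adv_dist advE)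
  (span_of_mx u w) uU b0 b1 bB bc cB kap0 kapb kapq.
have dmV : d%:R / m%:R = (m%:R / d%:R)^-1 :> R by rewrite invf_div.
have bV : b^-1 = z2 * (d%:R / m%:R) by rewrite /b -/z2 invfM invrK dmV.
have sV s (x : R) : 0 < s -> x = s^-1 * (m%:R / d%:R) ->
    (Num.sqrt x)^-1 = Num.sqrt s * Num.sqrt (d%:R / m%:R).
  move=> s0 ->; rewrite -sqrtrM ?(ltW s0) // dmV -sqrtrV; last by rewrite mulr_ge0 ?invr_ge0 ?(ltW s0) ?(ltW MD0).
  by rewrite invfM invrK.
rewrite /= -EFinM !lee_fin; apply/andP; split.
- rewrite ler_pdivlMr //; apply: le_trans la; rewrite /lower -(mulrA _ (Num.sqrt z1)) -(sV z1 B) //.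
  rewrite le_eqVlt; apply/orP; left; apply/eqP.
  by rewrite bV -/kap; field; rewrite !gt_eqF // sqrtr_gt0; exact: lt_le_trans bB.
- rewrite ler_pdivrMr //; apply: le_trans ua _; rewrite /upper -(mulrA _ (Num.sqrt z2)) -(sV z2 b) //.
  rewrite le_eqVlt; apply/orP; left; apply/eqP.
  by rewrite bV -/kap; field; rewrite !gt_eqF // sqrtr_gt0.
Qed.
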